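(* Let $d\in\{2,3\}$, let $\mathcal{T}_h$ be a triangular ($d=2$) or tetrahedral ($d=3$) mesh of $\Omega\subset\mathbb{R}^d$, and let $C=(c_{pqrs})$ be a homogeneous (i.e. constant in $x\in\Omega$), positive-definite elasticity tensor with the major symmetry $c_{pqrs}=c_{rspq}$ and the minor symmetry $c_{pqrs}=c_{qprs}=c_{pqsr}$. Let $P_i,P_j\in\mathcal{N}_h$ be two nodal points such that $j\in\Lambda_i$ (equivalently $i\in\Lambda_j$) and $\{P_i,P_j\}\not\subset\Gamma$. Then the spring constants satisfy $$K_{ij}=K_{ji}=K_{ij}^T .$$
   Context: $\Omega\subset\mathbb{R}^d$ is a bounded Lipschitz domain whose boundary $\Gamma=\partial\Omega$ is polygonal ($d=2$) or polyhedral ($d=3$). $\mathcal{T}_h=\{T^\alpha\}_{\alpha=1}^{N_e}$ is a (conforming) triangulation of $\Omega$ into closed triangles ($d=2$) or closed tetrahedra ($d=3$), and $\mathcal{N}_h=\{P_j\}_{j=1}^{N_p}$ is its set of nodal points (vertices). $P_1(\mathcal{T}_h)$ is the space of functions in $C^0(\overline\Omega)$ whose restriction to each $T^\alpha$ is linear (affine), and $\varphi_1,\dots,\varphi_{N_p}$ is its nodal basis, $\varphi_j(P_i)=\delta_{ij}$. $e_1,\dots,e_d$ is the standard basis of $\mathbb{R}^d$. A subscript $,p$ denotes $\partial/\partial x_p$. Positive-definiteness of $C$ means: there is $c_*>0$ with $\sum_{p,q,r,s}c_{pqrs}\xi_{pq}\xi_{rs}\ge c_*|\xi|^2$ for all symmetric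 $\xi\in\mathbb{R}^{d\times d}$. For $u\in H^1(\Omega)^d$, the strain is $e_{pq}[u]=\frac12(u_{p,q}+u_{q,p})$ and the stress is $\sigma_{pq}[u]=\sum_{r,s=1}^d c_{pqrs}e_{rs}[u]$; the bilinear form is $a(u,v)=\int_\Omega \sum_{p,q}\sigma_{pq}[u]\,e_{pq}[v]\,dx$. The spring constants are the matrices $K_{ij}=(K_{ij}^{kl})_{k,l=1,\dots,d}\in\mathbb{R}^{d\times d}$, $K_{ij}^{kl}:=-a(\varphi_j e_l,\varphi_i e_k)$, for $i,j\in\{1,\dots,N_p\}$, and $\Lambda_i:=\{j\in\{1,\dots,N_p\}\setminus\{i\}:\ K_{ij}\neq O\}$. *)

(* Defs.v *)
From HB Require Import structures.
From mathcomp Require Import all_boot all_order all_algebra.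
From mathcomp Require Import all_classical all_reals all_analysis.
Import Order.TTheory GRing.Theory Num.Theory.
Import numFieldNormedType.Exports.

Set Implicit Arguments.
Unset Strict Implicit.
Unset Printing Implicit Defensive.

Local Open Scope classical_set_scope.
Local Open Scope ring_scope.

Definition rV_display : measure_display. Proof. exact: default_measure_display. Qed.

Section measurable_rV.
Context (R : realType) (n : nat).

Let coord (i : 'I_n) (x : 'rV[R]_n) : R := x ord0 i.

Let rV_set0 : g_sigma_preimage coord set0.
Proof. exact: sigma_algebra0. Qed.

Let rV_setC A : g_sigma_preimage coord A -> g_sigma_preimage coord (~` A).
Proof. exact: sigma_algebraC. Qed.

Let rV_bigcup (F : (set 'rV[R]_n)^nat) :
  (forall i, g_sigma_preimage coord (F i)) ->
  g_sigma_preimage coord (\bigcup_i F i).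
Proof. exact: sigma_algebra_bigcup. Qed.

HB.instance Definition _ := @isMeasurable.Build rV_display
  'rV[R]_n (g_sigma_preimage coord) rV_set0 rV_setC rV_bigcup.

End measurable_rV.

Section lebesgue_rV.
Context (R : realType).
Implicit Type n : nat.

Lemma measurable_coord n (i : 'I_n) :
  measurable_fun [set: 'rV[R]_n] (fun x : 'rV[R]_n => x ord0 i).
Proof.
move=> _ Y mY; apply: sub_sigma_algebra.
rewrite -bigcup_seq/=; exists i => /=; first by rewrite mem_index_enum.
by exists Y.
Qed.

Lemma measurable_fun_rV d (T : measurableType d) n (f : T -> 'rV[R]_n) :
  (forall i, measurable_fun [set: T] (fun t => f t ord0 i)) ->
  measurable_fun [set: T] f.
Proof.
move=> mf; apply: measurability => //.
move=> _ [B + <-]; rewrite -bigcup_seq => -[i _ [C mC <-]].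
by rewrite setTI; exact: mf.
Qed.

Definition cons_rV n (p : measurableTypeR R * 'rV[R]_n) : 'rV[R]_n.+1 :=
  \row_i if unlift ord0 i is Some j then p.2 ord0 j else p.1.

Definition uncons_rV n (x : 'rV[R]_n.+1) : measurableTypeR R * 'rV[R]_n :=
  (x ord0 ord0, \row_j x ord0 (lift ord0 j)).

Lemma cons_rVK n : cancel (@cons_rV n) (@uncons_rV n).
Proof.
move=> [x y]; rewrite /uncons_rV mxE unlift_none; congr pair.
by apply/rowP => j; rewrite !mxE liftK.
Qed.

Lemma measurable_cons_rV n : measurable_fun [set: measurableTypeR R * 'rV[R]_n] (@cons_rV n).
Proof.
apply: measurable_fun_rV => i; under eq_fun do rewrite mxE.
case: unliftP => [j _|_]; last exact: measurable_fst.
by apply: (measurableT_comp (measurable_coord j)); exact: measurable_snd.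
Qed.

Lemma measurable_uncons_rV n : measurable_fun setT (@uncons_rV n).
Proof.
apply: (@measurable_fun_pair _ _ _ _ _ _ (fun x : 'rV[R]_n.+1 => x ord0 ord0)
  (fun x : 'rV[R]_n.+1 => \row_j x ord0 (lift ord0 j))).
  exact: measurable_coord.
apply: measurable_fun_rV => i; under eq_fun do rewrite mxE.
exact: measurable_coord.
Qed.

(* The n-fold product of the Lebesgue measure on R, carried by row vectors. *)
Fixpoint lebesgue_rV n : set 'rV[R]_n -> \bar R :=
  match n return set 'rV[R]_n -> \bar R with
  | 0 => dirac (0 : 'rV[R]_0)
  | m.+1 => pushforward (@lebesgue_measure R \x @lebesgue_rV m)%E
                        (@cons_rV m)
  end.

Lemma lebesgue_rV_sigma_finite_measure n :
  exists m : {sigma_finite_measure set 'rV[R]_n -> \bar R},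
    m = @lebesgue_rV n :> (set 'rV[R]_n -> \bar R).
Proof.
elim: n => [|n [m mE]].
  by exists (dirac (0 : 'rV[R]_0)).
pose l : {sigma_finite_measure set (measurableTypeR R) -> \bar R} :=
  @lebesgue_measure R.
pose p : {measure set (measurableTypeR R * 'rV[R]_n) -> \bar R} := (l \x m)%E.
have psf : sigma_finite setT (pushforward p (@cons_rV n)).
  have /sigma_finiteP[F [FT ndF Foo]] := sigma_finiteT l.
  have /sigma_finiteP[G [GT ndG Goo]] := sigma_finiteT m.
  exists (fun k => @uncons_rV n @^-1` (F k `*` G k)).
    rewrite -preimage_bigcup -[LHS](preimage_setT (@uncons_rV n)).
    congr (_ @^-1` _); rewrite -setXTT FT GT predeqE => -[x y]; split.
      move=> [/= [a _ Fx] [b _ Gy]]; exists (maxn a b) => //; split.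
      - by move: x Fx; exact/subsetPset/ndF/leq_maxl.
      - by move: y Gy; exact/subsetPset/ndG/leq_maxr.
    by move=> [a _ []/= ? ?]; split; exists a.
  move=> k; have [mFk Fk] := Foo k; have [mGk Gk] := Goo k.
  have mFG : measurable (F k `*` G k) by exact: measurableX.
  split; first by rewrite -[_ @^-1` _]setTI; exact: measurable_uncons_rV.
  rewrite /pushforward -comp_preimage (_ : _ \o _ = id); last first.
    by apply/funext => x /=; rewrite cons_rVK.
  rewrite preimage_id; have -> : p (F k `*` G k) = (l (F k) * m (G k))%E.
    exact: product_measure1E.
  by rewrite lte_mul_pinfty// ge0_fin_numE.
pose q := measure_function_pushforward__canonical__measure_function_Measure
  p (@measurable_cons_rV n).
pose sf := Measure_isSigmaFinite.Build _ _ _ (Measure.sort q) psf.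
pose q' := HB.pack_for {sigma_finite_measure set 'rV[R]_n.+1 -> \bar R}
  (Measure.sort q) sf.
by exists q'; rewrite /= -mE.
Qed.

Let lebesgue_rV0 n : @lebesgue_rV n set0 = 0%E.
Proof. by have [m <-] := lebesgue_rV_sigma_finite_measure n; rewrite measure0. Qed.

Let lebesgue_rV_ge0 n A : (0 <= @lebesgue_rV n A)%E.
Proof. by have [m <-] := lebesgue_rV_sigma_finite_measure n. Qed.

Let lebesgue_rV_semi_sigma_additive n : semi_sigma_additive (@lebesgue_rV n).
Proof.
have [m <-] := lebesgue_rV_sigma_finite_measure n.
exact: measure_semi_sigma_additive.
Qed.

HB.instance Definition _ n := isMeasure.Build _ _ _ (@lebesgue_rV n)
  (lebesgue_rV0 n) (@lebesgue_rV_ge0 n) (@lebesgue_rV_semi_sigma_additive n).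

Let lebesgue_rV_sigma_finite n : sigma_finite setT (@lebesgue_rV n).
Proof.
by have [m <-] := lebesgue_rV_sigma_finite_measure n; exact: sigma_finiteT.
Qed.

HB.instance Definition _ n := Measure_isSigmaFinite.Build _ _ _
  (@lebesgue_rV n) (@lebesgue_rV_sigma_finite n).

End lebesgue_rV.
Arguments lebesgue_rV {R n}.

Section domains.
Context (R : realType) (d : nat).
Implicit Types (Omega A : set 'rV[R]_d).

Definition boundary A : set 'rV[R]_d := closure A `\` interior A.

Definition hull (I : finType) (v : I -> 'rV[R]_d) (A : {set I}) : set 'rV[R]_d :=
  [set x | exists w : I -> R, [/\ (forall i, i \in A -> 0 <= w i),
    \sum_(i in A) w i = 1 & x = \sum_(i in A) w i *: v i]].

Definition affinely_independent (I : finType) (v : I -> 'rV[R]_d)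
    (A : {set I}) : Prop :=
  forall w : I -> R, \sum_(i in A) w i = 0 -> \sum_(i in A) w i *: v i = 0 ->
  forall i, i \in A -> w i = 0.

(* Near every boundary point, in the orthonormal coordinates y = x *m Q and for
   a distinguished axis k, Omega lies strictly above the graph of a Lipschitz
   function of the remaining d - 1 coordinates. *)
Definition lipschitz_boundary Omega : Prop :=
  forall x0, boundary Omega x0 ->
  exists r : R, exists Q : 'M[R]_d, exists k : 'I_d,
  exists gamma : 'rV[R]_d.-1 -> R,
  [/\ 0 < r, Q *m Q^T = 1%:M, lipschitz gamma &
    Omega `&` ball x0 r =
    [set x | gamma (col' k (x *m Q)) < (x *m Q) ord0 k] `&` ball x0 r].

Definition bounded_lipschitz_domain Omega : Prop :=
  [/\ open Omega, connected Omega, Omega !=set0, bounded_set Omega &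
      lipschitz_boundary Omega].

(* The boundary is a finite union of (d-1)-simplices: segments when d = 2,
   triangles when d = 3. *)
Definition polyhedral_boundary Omega : Prop :=
  exists (N : nat) (v : 'I_N -> 'I_d -> 'rV[R]_d),
    (forall f, affinely_independent (v f) [set: 'I_d]) /\
    boundary Omega = \bigcup_f hull (v f) [set: 'I_d].

End domains.

Section meshes.
Context (R : realType) (d : nat).

Record mesh := Mesh {
  n_nodes : nat;
  n_cells : nat;
  node : 'I_n_nodes -> 'rV[R]_d;
  cell_nodes : 'I_n_cells -> {set 'I_n_nodes} }.

Definition cell (T : mesh) (alpha : 'I_(n_cells T)) : set 'rV[R]_d :=
  hull (@node T) (cell_nodes alpha).

(* The last clause is conformity: two cells meet in the common face spanned by
   their shared vertices (hull of the empty set is empty). *)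
Definition triangulation (T : mesh) (Omega : set 'rV[R]_d) : Prop :=
  [/\ injective (@node T) /\ injective (@cell_nodes T),
      (forall alpha : 'I_(n_cells T), #|cell_nodes alpha| = d.+1 /\
         affinely_independent (@node T) (cell_nodes alpha)),
      (forall i : 'I_(n_nodes T), exists alpha, i \in cell_nodes alpha),
      closure Omega = \bigcup_alpha @cell T alpha &
      (forall alpha beta : 'I_(n_cells T), cell alpha `&` cell beta =
         hull (@node T) (cell_nodes alpha :&: cell_nodes beta))].

Definition P1 (T : mesh) (Omega : set 'rV[R]_d) (f : 'rV[R]_d -> R) : Prop :=
  {within closure Omega, continuous f} /\
  forall alpha : 'I_(n_cells T), exists (g : 'I_d -> R) (b : R),
    forall x, cell alpha x -> f x = \sum_p g p * x ord0 p + b.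

(* Values outside closure Omega are left unconstrained; nothing below looks at
   them. *)
Definition nodal_basis (T : mesh) (Omega : set 'rV[R]_d)
    (phi : 'I_(n_nodes T) -> 'rV[R]_d -> R) : Prop :=
  forall j, P1 T Omega (phi j) /\ forall i, phi j (node i) = (i == j)%:R.

End meshes.

Section weak_derivatives.
Context (R : realType) (d : nat).
Implicit Types (Omega : set 'rV[R]_d) (f u g psi : 'rV[R]_d -> R).

Definition unit_rV (p : 'I_d) : 'rV[R]_d := delta_mx ord0 p.

Definition partial (p : 'I_d) f : 'rV[R]_d -> R := fun x => 'D_(unit_rV p) f x.

Definition smooth f : Prop :=
  forall s : seq 'I_d, let g := foldr partial f s in
  continuous g /\ forall p x, derivable g x (unit_rV p).

Definition test_function Omega psi : Prop :=
  smooth psi /\ exists K : set 'rV[R]_d,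
    [/\ compact K, K `<=` Omega & forall x, ~ K x -> psi x = 0].

Definition L2 Omega f : Prop := f \_ Omega \in Lfun lebesgue_rV 2%:E.

Definition is_weak_partial Omega (p : 'I_d) u g : Prop :=
  L2 Omega g /\ forall psi, test_function Omega psi ->
    \int[lebesgue_rV]_(x in Omega) (u x * partial p psi x) =
    - \int[lebesgue_rV]_(x in Omega) (g x * psi x).

(* A representative of the weak derivative; 0 when there is none, which does
   not happen for u in H^1(Omega). *)
Definition weak_partial Omega (p : 'I_d) u : 'rV[R]_d -> R :=
  xget (cst 0) [set g | is_weak_partial Omega p u g].

End weak_derivatives.

Section elasticity.
Context (R : realType) (d : nat).

Definition tensor4 := 'I_d -> 'I_d -> 'I_d -> 'I_d -> R.
Implicit Types (C : tensor4) (Omega : set 'rV[R]_d) (u v : 'rV[R]_d -> 'rV[R]_d).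

Definition major_symmetric C : Prop := forall p q r s, C p q r s = C r s p q.

Definition minor_symmetric C : Prop :=
  forall p q r s, C p q r s = C q p r s /\ C p q r s = C p q s r.

Definition positive_definite C : Prop :=
  exists2 c : R, 0 < c & forall xi : 'M[R]_d, xi^T = xi ->
    c * (\sum_p \sum_q xi p q ^+ 2) <=
    \sum_p \sum_q \sum_r \sum_s C p q r s * xi p q * xi r s.

Definition strain Omega u (p q : 'I_d) (x : 'rV[R]_d) : R :=
  2^-1 * (weak_partial Omega q (fun y => u y ord0 p) x +
          weak_partial Omega p (fun y => u y ord0 q) x).

Definition stress C Omega u (p q : 'I_d) (x : 'rV[R]_d) : R :=
  \sum_r \sum_s C p q r s * strain Omega u r s x.

Definition elastic_form C Omega u v : R :=
  \int[lebesgue_rV]_(x in Omega)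
    (\sum_p \sum_q stress C Omega u p q x * strain Omega v p q x).

Definition spring_constant C Omega (N : nat) (phi : 'I_N -> 'rV[R]_d -> R)
    (i j : 'I_N) : 'M[R]_d :=
  \matrix_(k, l) - elastic_form C Omega (fun x => phi j x *: unit_rV R l)
                                        (fun x => phi i x *: unit_rV R k).

Definition neighbours C Omega (N : nat) (phi : 'I_N -> 'rV[R]_d -> R)
    (i : 'I_N) : {set 'I_N} :=
  [set j | j != i & spring_constant C Omega phi i j != 0]%SET.

End elasticity.

(* Main.v *)
(* By the symmetries of C, the entry K_ij^kl is minus the sum over q, s of
   c_kqls * \int (d_q phi_i)(d_s phi_j), so everything reduces to showing that
   B_qs = \int (d_q phi_i)(d_s phi_j) is symmetric in q, s as soon as one of the
   two nodes, say P_i, lies in the open set Omega.  Near P_i the hat function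
   phi_i is conical, so its cap f = max(phi_i - (1 - lam), 0) is, for small lam,
   compactly supported in Omega, and its gradient on the corner at P_i of a cell
   is that of phi_i; these corners are the cells scaled by lam about P_i, so
   \int (d_q f)(d_s phi_j) = lam^d * B_qs.  For f, with the forward difference
   quotients D^t_q, discrete integration by parts gives
   \int (D^t_q f)(D^-t_s phi_j) = \int (D^t_s f)(D^-t_q phi_j), and t tends to 0
   by dominated convergence.

   The stress is built from an arbitrary representative of the weak derivatives.
   Difference quotients show that the piecewise constant gradient of phi_j is a
   weak derivative, and testing against bumps that tend to indicators of boxes
   shows that weak derivatives are unique almost everywhere. *)

Require Import Defs.
From mathcomp Require Import all_boot all_order all_algebra.
From mathcomp Require Import all_classical all_reals all_analysis.
From mathcomp Require Import measurable_realfun ring lra.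
Import Order.TTheory GRing.Theory Num.Theory.
Import numFieldNormedType.Exports.

Local Open Scope classical_set_scope.
Local Open Scope ring_scope.

Set Implicit Arguments.
Unset Strict Implicit.

(** * Lebesgue measure on row vectors *)

(** The obstacle is the boundary of [Omega]. Extended by zero, [phi j] may jump there, its
    difference quotients then grow like 1/t, and no domination holds. The star of an interior node
    can touch the boundary, so [phi i] does not keep the quotients away from it; its cap does,
    because only a small homothetic copy of the star is left. The price is the factor lam^d, which
    is the same for all cells and all pairs of indices and therefore cancels.

    Translations replace the divergence theorem on polyhedra and the matching of jump terms across
    faces: the agreement of neighbouring cells on common faces enters through a Lipschitz bound
    along axis-parallel segments.

    The Lipschitz boundary serves to place the open cells in [Omega] and not merely in its closure,
    so that [Omega] is, up to a null set, the disjoint union of the open cells and its integrals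
    split cell by cell.

    Of the two equalities, K_ji = K_ij^T is the symmetry of the bilinear form; K_ij = K_ji is where
    an interior node is used. *)

Lemma lebesgue_measure_affine {R : realType} (a b : R) (A : set (measurableTypeR R)) :
  0 < a -> measurable A ->
  (a%:E * lebesgue_measure ((fun x => (a * x + b)%R) @^-1` A) = lebesgue_measure A)%E.
Proof.
move=> a0 mA.
have mf : measurable_fun [set: measurableTypeR R]
    (fun x => a * x + b : measurableTypeR R).
  by apply: measurable_funD => //; exact: mulrl_measurable.
pose a' : {nonneg R} := NngNum (ltW a0).
pose p := measure_function_pushforward__canonical__measure_function_Measure
  (@lebesgue_measure R) mf.
pose q : {measure set (measurableTypeR R) -> \bar R} := mscale a' p.
suff : lebesgue_measure A = q A by move=> ->.
apply: lebesgue_measure_unique => // _ [[u v]] _ <-.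
have -> : q `]u, v]%classic = (a%:E * lebesgue_measure
    ((fun x : R => (a * x + b)%R) @^-1` `]u, v]))%E by [].
have -> : (fun x : R => a * x + b) @^-1` `]u, v] = `](u - b) / a, (v - b) / a]%classic.
  apply/seteqP; split => x /=; rewrite !in_itv/= ltr_pdivrMr// ler_pdivlMr//;
  by rewrite ltrBlDr lerBrDr (mulrC x).
rewrite !lebesgue_measure_itv/= !lte_fin ltr_pM2r ?invr_gt0// ltrD2r.
case: ifPn => _; last by rewrite mule0.
rewrite -!EFinB -EFinM; congr EFin.
by field; rewrite gt_eqF.
Qed.

Section lebesgue_rV_theory.
Context {R : realType}.
Implicit Type n : nat.

Lemma measurable_affine_rV n (a : R) (b : 'rV[R]_n) :
  measurable_fun setT (fun x : 'rV[R]_n => a *: x + b).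
Proof.
apply: measurable_fun_rV => i; under eq_fun do rewrite !mxE.
apply: measurable_funD => //; apply: measurable_funM => //.
exact: measurable_coord.
Qed.

(** By uniqueness of the product measure it is enough to compare both sides on rectangles, where the
    first coordinate contributes [a] and the others a^n by induction. Both translations ([a = 1])
    and homotheties about a point are instances. *)
Lemma lebesgue_rV_affine n (a : R) (b : 'rV[R]_n) (A : set 'rV[R]_n) :
  0 < a -> measurable A ->
  ((a ^+ n)%:E * lebesgue_rV ((fun x => (a *: x + b)%R) @^-1` A) = lebesgue_rV A)%E.
Proof.
move=> a0; elim: n b A => [|n IH] b A mA.
  rewrite expr0 mul1e; congr (lebesgue_rV _); apply/seteqP; split => x /=;
  by rewrite (_ : a *: x + b = x)//; apply/rowP => -[].
pose l : {sigma_finite_measure set (measurableTypeR R) -> \bar R} := @lebesgue_measure R.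
pose m : {sigma_finite_measure set 'rV[R]_n -> \bar R} := @lebesgue_rV R n.
pose f (p : measurableTypeR R * 'rV[R]_n) : measurableTypeR R * 'rV[R]_n :=
  (a * p.1 + b ord0 ord0, a *: p.2 + \row_j b ord0 (lift ord0 j)).
have mf : measurable_fun setT f.
  apply: measurable_fun_pair.
    apply: measurable_funD => //; apply: measurable_funM => //; exact: measurable_fst.
  exact: (measurableT_comp (measurable_affine_rV _ _)).
pose p := measure_function_pushforward__canonical__measure_function_Measure
  (l \x m)%E mf.
pose a' : {nonneg R} := NngNum (exprn_ge0 n.+1 (ltW a0)).
pose q : {measure set (measurableTypeR R * 'rV[R]_n) -> \bar R} := mscale a' p.
have mcA : measurable (@cons_rV R n @^-1` A).
  by rewrite -[X in measurable X]setTI; exact: measurable_cons_rV.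
have -> : lebesgue_rV A = (l \x m)%E (@cons_rV R n @^-1` A) by [].
rewrite (@product_measure_unique _ _ _ _ _ l m q)//; last first.
  move=> B C mB mC.
  have -> : q (B `*` C) = ((a ^+ n.+1)%:E * (l \x m)%E (f @^-1` (B `*` C)))%E by [].
  have -> : f @^-1` (B `*` C) =
     ((fun x => a * x + b ord0 ord0) @^-1` B) `*`
     ((fun x => a *: x + \row_j b ord0 (lift ord0 j)) @^-1` C).
    by apply/seteqP; split => -[x y].
  have m1 : measurable
      ((fun x : measurableTypeR R => a * x + b ord0 ord0 : measurableTypeR R) @^-1` B).
    rewrite -[X in measurable X]setTI.
    by apply: measurable_funD => //; apply: measurable_funM.
  have m2 : measurable ((fun x => a *: x + \row_j b ord0 (lift ord0 j)) @^-1` C).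
    by rewrite -[X in measurable X]setTI; exact: measurable_affine_rV.
  rewrite product_measure1E// exprS EFinM muleACA.
  by congr (_ * _)%E; [exact: lebesgue_measure_affine|exact: IH].
have -> : q (@cons_rV R n @^-1` A) =
  ((a ^+ n.+1)%:E * (l \x m)%E (f @^-1` (@cons_rV R n @^-1` A)))%E by [].
congr (_ * _)%E; rewrite [LHS]/= /pushforward; congr ((l \x m)%E _).
apply/seteqP; split => -[x y] /=;
  rewrite (_ : cons_rV (f (x, y)) = a *: cons_rV (x, y) + b)//;
  apply/rowP => i; rewrite !mxE; case: unliftP => [j ->|->] /=; by rewrite ?mxE.
Qed.

Lemma measurable_forall_coord n (S : 'I_n -> set R) : (forall i, measurable (S i)) ->
  measurable [set x : 'rV[R]_n | forall i, S i (x ord0 i)].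
Proof.
move=> mS.
have -> : [set x : 'rV[R]_n | forall i, S i (x ord0 i)] =
    \big[setI/setT]_(i < n) ((fun x : 'rV[R]_n => x ord0 i) @^-1` S i).
  apply/seteqP; split => x; rewrite -bigcap_seq => xS i; first by move=> _; exact: xS.
  by apply: xS; rewrite /= mem_index_enum.
apply: bigsetI_measurable => i _; rewrite -[X in measurable X]setTI.
exact: measurable_coord.
Qed.

Lemma coord_le_norm n (x : 'rV[R]_n) i : `|x ord0 i| <= `|x|.
Proof. by rewrite [leRHS]mx_normrE; apply: (le_bigmax _ _ (ord0, i)). Qed.

Definition cube n (M : R) : set 'rV[R]_n := [set x | forall i, `|x ord0 i| <= M].

Lemma measurable_cube n M : measurable (@cube n M).
Proof.
apply: (measurable_forall_coord (S := fun=> [set y | `|y| <= M])) => i.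
rewrite (_ : mkset _ = `[- M, M]%classic)//.
by apply/seteqP; split => y /=; rewrite in_itv/= ler_norml.
Qed.

Lemma lebesgue_rV_cube n M : (lebesgue_rV (@cube n M) < +oo)%E.
Proof.
elim: n => [|n IH]; first by rewrite /= diracE ltry.
have -> : lebesgue_rV (@cube n.+1 M) =
  (@lebesgue_measure R \x @lebesgue_rV R n)%E (`[- M, M] `*` @cube n M).
  rewrite [LHS]/= /pushforward; congr (_ _).
  apply/seteqP; split => -[x y] /=.
    move=> xM; split.
      by have := xM ord0; rewrite mxE unlift_none in_itv/= -ler_norml.
    by move=> i; have := xM (lift ord0 i); rewrite mxE liftK.
  rewrite in_itv/= -ler_norml => -[xM yM] i; rewrite mxE.
  by case: unliftP.
rewrite product_measure1E//; last exact: measurable_cube.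
pose I : set (measurableTypeR R) := `[- M, M]%classic.
have l1 : (@lebesgue_measure R I < +oo)%E.
  by rewrite lebesgue_measure_itv/=; case: ifPn => // _; rewrite -EFinB ltry.
by rewrite lte_mul_pinfty// ge0_fin_numE//; exact: l1.
Qed.

Lemma measurable_ball_rV n (c : 'rV[R]_n) (r : R) : measurable (ball c r).
Proof.
have [r0|r0] := leP r 0.
  by rewrite (_ : ball c r = set0)//; apply/seteqP; split => // x [/lt_geF]; rewrite r0.
have -> : ball c r = [set x | forall i, ball (c ord0 i) r (x ord0 i)].
  apply/seteqP; split => x; first by move=> [_ cx] i; exact: cx.
  by move=> cx; split => // i j; rewrite (ord1 i); exact: cx.
apply: (measurable_forall_coord (S := fun i => ball (c ord0 i) r)) => i.
exact: measurable_ball.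
Qed.

End lebesgue_rV_theory.

(** * Bounded functions of bounded support and discrete integration by parts *)

Section measure_rV.
Context {R : realType} {n : nat}.
Local Notation mu := (@lebesgue_rV R n).
Implicit Types (f g a b : 'rV[R]_n -> R) (O : set 'rV[R]_n).

(** The balls have rational centres and radii 1/(m+1); a ball whose double leaves [O] gets radius 0,
    which makes it empty. The doubled radius gives room for closed boxes inside [O] around each
    ball. *)
Lemma open_rV_cover O : open O ->
  exists (c : nat -> 'rV[R]_n) (r : nat -> R),
    (forall k, ball (c k) (2 * r k) `<=` O) /\ O `<=` \bigcup_k ball (c k) (r k).
Proof.
move=> oO.
pose c k : 'rV[R]_n :=
  if @unpickle ('rV[rat]_n * nat)%type k is Some qm then map_mx ratr qm.1 else 0.
pose r0 k : R :=
  if @unpickle ('rV[rat]_n * nat)%type k is Some qm then qm.2.+1%:R^-1 else 0.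
pose r k : R := if pselect (ball (c k) (2 * r0 k) `<=` O) then r0 k else 0.
exists c, r; split.
  move=> k; rewrite /r; case: pselect => [xO|nO]; first exact: xO.
  move=> y; rewrite mulr0.
  by case; rewrite ltxx.
move=> x Ox; have /nbhs_ballP[e /= e0 xeO] := open_nbhs_nbhs (conj oO Ox).
(* If the centre is within [s] of [x], its ball of radius 2s lies in the ball of radius 3s about
   [x]. *)
have [m /= m3] : exists m, 3 * m.+1%:R^-1 < e.
  have e3 : 0 < e / 3 by rewrite divr_gt0.
  have [m _ /(_ _ (leqnn m))] := near_infty_natSinv_lt (PosNum e3).
  by rewrite /= ltr_pdivlMr// mulrC; exists m.
set s : R := m.+1%:R^-1 in m3.
have s0 : 0 < s by rewrite invr_gt0.
have q_ i : exists q : rat, `|ratr q - x ord0 i| < s.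
  have : x ord0 i - s < x ord0 i + s by rewrite ltrBlDr -addrA ltrDl addr_gt0.
  by move=> /rat_in_itvoo[q]; rewrite in_itv/= -ltr_distl => ?; exists q.
pose q : 'rV[rat]_n := \row_i sval (cid (q_ i)).
have qP i : `|ratr (q ord0 i) - x ord0 i| < s by rewrite mxE; case: cid.
pose k := pickle (q, m).
have ck : c k = map_mx ratr q by rewrite /c pickleK.
have rk : r0 k = s by rewrite /r0 pickleK.
have rE : r k = s.
  rewrite /r; case: pselect => //= -[]; rewrite ck rk => y [_ qy].
  apply: xeO; split => // i j; rewrite (ord1 i); have := qy ord0 j.
  rewrite /= !mxE /ball/= => qyj.
  have := qP j; rewrite mxE; set u := ratr _ in qyj *; move=> uj.
  apply: le_lt_trans m3.
  have -> : x ord0 j - y ord0 j = (x ord0 j - u) + (u - y ord0 j) by ring.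
  rewrite (le_trans (ler_normD _ _))// distrC.
  by apply: ltW; rewrite (lt_le_trans (ltrD uj qyj))// ; lra.
exists k => //; rewrite ck rE; split => // i j; rewrite (ord1 i) mxE /ball/=.
exact: qP.
Qed.

(** The sigma-algebra is generated by the coordinates and not by the open sets, so this needs the
    countable cover by balls, which are boxes in the sup norm. *)
Lemma open_measurable_rV O : open O -> measurable O.
Proof.
move=> oO; have [c [r [crO Ocr]]] := open_rV_cover oO.
suff -> : O = \bigcup_k ball (c k) (r k).
  by apply: bigcupT_measurable => k; exact: measurable_ball_rV.
apply/seteqP; split => // x [k _ [rk0 ckx]]; apply: (crO k).
split; first by rewrite mulr_gt0.
by move=> i j; apply: le_ball (ckx i j); rewrite ler_peMl// ?ltW// ltr1n.
Qed.

Lemma continuous_measurable_rV f : continuous f -> measurable_fun setT f.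
Proof.
move=> cf; apply: (measurability _ (RGenOpens.measurableE R)) => //.
move=> _ [_ [a [b ->]] <-]; rewrite setTI; apply: open_measurable_rV.
by apply: open_comp => //; exact: interval_open.
Qed.

(** One constant serves both as a bound and as the size of a cube containing the support. The class
    is stable under products, translations and difference quotients and lies in L^1 and L^2, which
    settles integrability throughout. *)
Definition bmfun f := measurable_fun setT f /\
  exists M, forall x, `|f x| <= M * \1_(cube M) x.

Lemma bmfunP f M : measurable_fun setT f ->
  (forall x, `|f x| <= M) -> (forall x, ~ cube M x -> f x = 0) -> bmfun f.
Proof.
move=> mf fM f0; split => //; exists M => x; rewrite indicE.
case: (pselect (cube M x)) => xM; first by rewrite mem_set// mulr1.
by rewrite memNset// f0// normr0 mulr0.
Qed.

Lemma bmfun_bounded f : bmfun f -> exists2 M, 0 <= M & forall x, `|f x| <= M.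
Proof.
move=> [_ [M fM]]; exists `|M| => // x; rewrite (le_trans (fM x))// indicE.
by case: (_ \in _); rewrite ?mulr1 ?mulr0 ?ler_norm.
Qed.

Lemma bmfun_supp f : bmfun f -> exists2 M, 0 <= M & forall x, ~ cube M x -> f x = 0.
Proof.
move=> [_ [M fM]]; exists `|M| => // x xM; apply/eqP; rewrite -normr_le0.
rewrite (le_trans (fM x))// indicE memNset ?mulr0// => xM'; apply: xM => i.
exact: le_trans (xM' i) (ler_norm _).
Qed.

Lemma cubeS M M' : M <= M' -> @cube R n M `<=` cube M'.
Proof. by move=> MM' x xM i; exact: le_trans (xM i) MM'. Qed.

Lemma bmfun_intro f M M' : measurable_fun setT f ->
  (forall x, `|f x| <= M) -> (forall x, ~ cube M' x -> f x = 0) -> bmfun f.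
Proof.
move=> mf fM f0; apply: (@bmfunP _ (Num.max M M')) => // x.
  by rewrite le_max fM.
move=> xM; apply: f0 => /(@cubeS _ (Num.max M M')) xM'; apply/xM/xM'.
by rewrite le_max lexx orbT.
Qed.

Lemma integrable_cube M M' :
  mu.-integrable setT (EFin \o (fun x => M * \1_(cube M') x)).
Proof.
have mc := @measurable_cube R n M'.
under [X in _.-integrable _ X]eq_fun do rewrite /= EFinM.
apply: integrableZl => //; apply/integrableP; split.
  exact/measurable_EFinP/measurable_indic.
rewrite (eq_integral (fun x => (\1_(@cube R n M') x)%:E)); last first.
  by move=> t _; rewrite gee0_abs// lee_fin.
by rewrite integral_indic// setIT; exact: lebesgue_rV_cube.
Qed.

Lemma bmfun_integrable f : bmfun f -> mu.-integrable setT (EFin \o f).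
Proof.
move=> [mf [M fM]]; apply: le_integrable (integrable_cube M M) => //.
  exact/measurable_EFinP.
by move=> x _ /=; rewrite lee_fin (le_trans (fM x))// ler_norm.
Qed.

Lemma bmfunMr f g : bmfun f -> measurable_fun setT g ->
  (exists M, forall x, f x != 0 -> `|g x| <= M) -> bmfun (fun x => f x * g x).
Proof.
move=> bf mg [G gG]; have [M M0 fM] := bmfun_bounded bf.
have [M' _ f0] := bmfun_supp bf.
apply: (@bmfun_intro _ (M * `|G|) M').
- by apply: measurable_funM => //; case: bf.
- move=> x; have [->|fx0] := eqVneq (f x) 0; first by rewrite mul0r normr0 mulr_ge0.
  by rewrite normrM ler_pM// (le_trans (gG _ fx0))// ler_norm.
- by move=> x /f0 ->; rewrite mul0r.
Qed.

Lemma bmfunM f g : bmfun f -> bmfun g -> bmfun (fun x => f x * g x).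
Proof.
move=> bf bg; apply: bmfunMr => //; first by case: bg.
by have [M _ gM] := bmfun_bounded bg; exists M.
Qed.

Lemma bmfunD f g : bmfun f -> bmfun g -> bmfun (fun x => f x + g x).
Proof.
move=> bf bg; have [M M0 fM] := bmfun_bounded bf.
have [M' _ f0] := bmfun_supp bf; have [N N0 gN] := bmfun_bounded bg.
have [N' _ g0] := bmfun_supp bg.
apply: (@bmfun_intro _ (M + N) (Num.max M' N')).
- by apply: measurable_funD; [case: bf|case: bg].
- by move=> x; rewrite (le_trans (ler_normD _ _))// lerD.
- move=> x xM; rewrite f0 ?g0 ?addr0// => xM'; apply: xM.
  + by apply: cubeS xM'; rewrite le_max lexx orbT.
  + by apply: cubeS xM'; rewrite le_max lexx.
Qed.

Lemma bmfunZ k f : bmfun f -> bmfun (fun x => k * f x).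
Proof.
move=> bf; have [M M0 fM] := bmfun_bounded bf.
have [M' _ f0] := bmfun_supp bf; apply: (@bmfun_intro _ (`|k| * M) M').
- by apply: measurable_funM => //; case: bf.
- by move=> x; rewrite normrM ler_wpM2l.
- by move=> x /f0 ->; rewrite mulr0.
Qed.

Lemma bmfunB f g : bmfun f -> bmfun g -> bmfun (fun x => f x - g x).
Proof.
move=> bf bg; apply: bmfunD => //.
by under eq_fun do rewrite -mulN1r; exact: bmfunZ.
Qed.

Lemma measurable_shift (v : 'rV[R]_n) : measurable_fun setT (fun x : 'rV[R]_n => x + v).
Proof.
apply: measurable_fun_rV => i; under eq_fun do rewrite mxE.
by apply: measurable_funD => //; exact: measurable_coord.
Qed.

Lemma bmfun_shift f v : bmfun f -> bmfun (fun x => f (x + v)).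
Proof.
move=> bf; have [M M0 fM] := bmfun_bounded bf.
have [M' _ f0] := bmfun_supp bf; apply: (@bmfun_intro _ M (M' + `|v|)) => //.
  by case: bf => mf _; apply: (measurableT_comp mf); exact: measurable_shift.
move=> x xM; apply: f0 => xM'; apply: xM => i.
have -> : x ord0 i = (x + v) ord0 i - v ord0 i by rewrite !mxE addrK.
rewrite (le_trans (ler_normB _ _))// lerD//.
exact: coord_le_norm.
Qed.

Lemma Rintegral_shift f v : bmfun f ->
  (\int[mu]_x f (x + v) = \int[mu]_x f x)%R.
Proof.
move=> bf; congr fine.
have mv := measurable_shift v.
transitivity (\int[pushforward mu (fun x : 'rV[R]_n => x + v)%R]_x (f x)%:E)%E.
  rewrite integral_pushforward//=.
    by case: bf => mf _; exact/measurable_EFinP.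
  by rewrite preimage_setT; exact: (bmfun_integrable (bmfun_shift v bf)).
apply: eq_measure_integral => A mA _.
have := lebesgue_rV_affine v ltr01 mA; rewrite expr1n mul1e; apply: etrans.
by congr (mu _); apply/seteqP; split => x /=; rewrite scale1r.
Qed.

(** The step may have either sign. For [t = 0] the value is 0, since the inverse of 0 is 0. *)
Definition diff_quot (v : 'rV[R]_n) (t : R) f x := t^-1 * (f (x + t *: v) - f x).

Lemma bmfun_diff_quot v t f : bmfun f -> bmfun (diff_quot v t f).
Proof.
move=> bf; by apply: bmfunZ; apply: bmfunB => //; exact: bmfun_shift.
Qed.

Lemma diff_quotC v w s t f : diff_quot v s (diff_quot w t f) = diff_quot w t (diff_quot v s f).
Proof.
apply/funext => x; by rewrite /diff_quot (addrAC x (s *: v)); ring.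
Qed.

(** Translation invariance of the measure moves the shift from [a] to [b] and reverses its
    direction. *)
Lemma diff_quot_by_parts v t a b : bmfun a -> bmfun b ->
  \int[mu]_x (diff_quot v t a x * b x) = - \int[mu]_x (a x * diff_quot v (- t) b x).
Proof.
move=> ba bb; rewrite /diff_quot; set w := t *: v.
have bi f : bmfun f -> mu.-integrable setT (EFin \o f) by exact: bmfun_integrable.
have b1 := bmfunM (bmfun_shift w ba) bb.
have b0 := bmfunM ba bb.
have b2 := bmfunM ba (bmfun_shift (- w) bb).
transitivity (t^-1 * \int[mu]_x (a (x + w) * b x - a x * b x)).
  rewrite -RintegralZl//; last by apply: bi; exact: bmfunB.
  by apply: eq_Rintegral => x _; ring.
transitivity (t^-1 * \int[mu]_x (a x * b (x - w) - a x * b x)); last first.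
  rewrite -mulN1r -!RintegralZl//; last 2 first.
  - by apply: bi; apply: bmfunM => //; apply: bmfunZ; apply: bmfunB => //; exact: bmfun_shift.
  - by apply: bi; exact: bmfunB.
  by apply: eq_Rintegral => x _; rewrite scaleNr invrN; ring.
congr (_ * _); rewrite !RintegralB//; try exact: bi.
congr (_ - _); rewrite -(Rintegral_shift w b2).
by apply: eq_Rintegral => x _; rewrite addrK.
Qed.

(* The two integrands differ by a discrete divergence: moving both difference
   operators onto [b] makes the two sides equal, since translations commute. *)
Lemma diff_quot_diff_quot_sym v w t a b : bmfun a -> bmfun b ->
  \int[mu]_x (diff_quot v t a x * diff_quot w (- t) b x) =
  \int[mu]_x (diff_quot w t a x * diff_quot v (- t) b x).
Proof.
by move=> ba bb; rewrite !diff_quot_by_parts//; [|exact: bmfun_diff_quot..]; rewrite diff_quotC.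
Qed.

(** The dominating function is [M] times the indicator of [cube M]; callers therefore take for [M]
    the maximum of a uniform bound and a support size. *)
Lemma bounded_cvg_Rintegral (F : nat -> 'rV[R]_n -> R) f M :
  (forall k, measurable_fun setT (F k)) -> measurable_fun setT f ->
  (forall k x, `|F k x| <= M) -> (forall k x, ~ cube M x -> F k x = 0) ->
  {ae mu, forall x, F k x @[k --> \oo] --> f x} ->
  \int[mu]_x F k x @[k --> \oo] --> \int[mu]_x f x.
Proof.
move=> mF mf FM F0 Ff.
have [|||||fi _ cvgF] := @dominated_convergence _ _ R mu setT measurableT
  (fun k => EFin \o F k) (EFin \o f) (EFin \o (fun x => M * \1_(cube M) x)).
- by move=> k; exact/measurable_EFinP.
- exact/measurable_EFinP.
- apply: filterS Ff => x Fx _; apply: cvg_EFin => //; exact: nearW.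
- exact: integrable_cube.
- apply: aeW => x k _ /=; rewrite lee_fin indicE.
  case: (pselect (cube M x)) => xM; first by rewrite mem_set// mulr1.
  by rewrite F0// normr0 memNset// mulr0.
- by apply: fine_cvg; rewrite fineK//; exact: integrable_fin_num.
Qed.

Lemma bounded_set_cube (A : set 'rV[R]_n) : bounded_set A ->
  exists M, forall M', M < M' -> A `<=` cube M'.
Proof.
move=> [M [_ AM]]; exists M => M' MM' x Ax i.
exact: le_trans (coord_le_norm _ _) (AM _ MM' x Ax).
Qed.

Lemma bmfun_indic (O : set 'rV[R]_n) : measurable O -> bounded_set O -> bmfun (\1_O : _ -> R).
Proof.
move=> mO /bounded_set_cube[M OM].
apply: (@bmfun_intro _ 1 (M + 1)); first exact: measurable_indic.
  by move=> x; rewrite indicE; case: (_ \in _); rewrite ?normr1 ?normr0.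
move=> x xM; rewrite indicE memNset// => /OM xM'; apply/xM/xM'.
by rewrite ltrDl.
Qed.

Lemma compact_supp_bmfun f (K : set 'rV[R]_n) : continuous f -> compact K ->
  (forall x, ~ K x -> f x = 0) -> bmfun f.
Proof.
move=> cf cK f0.
have [M [_ fM]] := compact_bounded (continuous_compact (continuous_subspaceT cf) cK).
have [N KN] := bounded_set_cube (compact_bounded cK).
have M1 : M < M + 1 by rewrite ltrDl.
apply: (@bmfun_intro _ (Num.max (M + 1) 0) (N + 1)).
- exact: continuous_measurable_rV.
- move=> x; have [Kx|/f0 ->] := pselect (K x).
    by rewrite le_max (fM _ M1)//; exists x.
  by rewrite normr0 le_max lexx orbT.
- by move=> x xN; apply: f0 => /KN xN'; apply/xN/xN'; rewrite ltrDl.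
Qed.

Lemma bmfun_sum (I : Type) (s : seq I) (F : I -> 'rV[R]_n -> R) :
  (forall k, bmfun (F k)) -> bmfun (fun x => \sum_(k <- s) F k x).
Proof.
move=> bF; elim: s => [|k s IH].
  under eq_fun do rewrite big_nil.
  by apply: (@bmfun_intro _ 0 0) => // x; rewrite normr0.
by under eq_fun do rewrite big_cons; exact: bmfunD.
Qed.

Lemma bmfun_L2 (f : 'rV[R]_n -> R) : bmfun f -> f \in Lfun mu 2%:E.
Proof.
move=> bf; rewrite inE; apply/andP; split; rewrite inE/=; first by case: bf.
rewrite /finite_norm unlock poweR_lty//.
have := bmfun_integrable (bmfunM bf bf) => /integrableP[_].
congr (_ < _)%E; apply: eq_integral => x _ /=.
by rewrite normrM -expr2 -powR_mulrn.
Qed.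

Lemma Rintegral_sum_indic (I : finType) (c : I -> R) (S : I -> set 'rV[R]_n) :
  (forall k, measurable (S k)) -> (forall k, bounded_set (S k)) ->
  \int[mu]_x (\sum_k c k * \1_(S k) x) = \sum_k fine (mu (S k)) * c k.
Proof.
move=> mS bS.
have b1 k : bmfun (fun x => c k * \1_(S k) x) by apply: bmfunZ; exact: bmfun_indic.
have ik k : \int[mu]_x (c k * \1_(S k) x) = fine (mu (S k)) * c k.
  rewrite RintegralZl//; last exact: (bmfun_integrable (bmfun_indic (mS k) (bS k))).
  by rewrite mulrC /Rintegral integral_indic// setIT.
elim: (index_enum I) => [|k s IH].
  by under eq_Rintegral do rewrite big_nil; rewrite Rintegral_cst// mul0r big_nil.
under eq_Rintegral do rewrite big_cons; rewrite RintegralD// ?big_cons ?IH ?ik//.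
  exact: bmfun_integrable.
exact: bmfun_integrable (bmfun_sum s b1).
Qed.

End measure_rV.

(** * Smooth bumps *)

Lemma is_derive_cvg {R : realType} {V W : normedModType R} (f : V -> W) x v l :
  h^-1 *: ((f \o shift x) (h *: v) - f x) @[h --> 0^'] --> l -> is_derive x v f l.
Proof. by move=> fl; apply: DeriveDef; [exact: cvgP fl|exact: cvg_lim fl]. Qed.

Section flat_exponential.
Context {R : realType}.
Implicit Types (P : {poly R}) (x y s c : R).

(** Write e^y as the (k+1)-st power of e^(y/(k+1)): bound [k] of the factors below by y/(k+1) and
    the last one by 1. *)
Lemma exprn_le_expR (k : nat) y : 0 <= y -> y ^+ k * expR (- y) <= k.+1%:R ^+ k.
Proof.
move=> y0; rewrite expRN ler_pdivrMr ?expR_gt0//.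
have -> : expR y = expR (y / k.+1%:R) ^+ k.+1.
  by rewrite -expRM_natl mulrC divfK// pnatr_eq0.
have e1 : 1 <= expR (y / k.+1%:R).
  by rewrite (le_trans _ (expR_ge1Dx _))// lerDl divr_ge0.
apply: (@le_trans _ _ (k.+1%:R ^+ k * expR (y / k.+1%:R) ^+ k)).
  rewrite -exprMn lerXn2r ?nnegrE ?mulr_ge0 ?expR_ge0//.
  rewrite mulrC -ler_pdivrMr ?ltr0Sn//.
  by rewrite (le_trans _ (expR_ge1Dx _))// lerDr.
by rewrite ler_wpM2l ?exprn_ge0// exprS ler_peMl// exprn_ge0// expR_ge0.
Qed.

Lemma horner_expR_bounded P : exists c, forall y, 0 <= y -> `|P.[y]| * expR (- y) <= c.
Proof.
exists (\sum_(i < size P) `|P`_i| * i.+1%:R ^+ i) => y y0.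
rewrite horner_coef (le_trans (ler_wpM2r (expR_ge0 _) (ler_norm_sum _ _ _)))//.
rewrite mulr_suml ler_sum// => i _; rewrite normrM -mulrA ler_wpM2l//.
by rewrite ger0_norm ?exprn_ge0// exprn_le_expR.
Qed.

(** The polynomial in 1/x makes the family of exp(-1/x) closed under differentiation;
    [flat_exp_next] is the map that differentiation induces on the polynomials. *)
Definition flat_exp P x := if 0 < x then P.[x^-1] * expR (- x^-1) else 0.

Definition flat_exp_next P : {poly R} := 'X^2 * (P - P^`()).

(** A quadratic bound at 0 makes the difference quotients there vanish in the limit. It is the
    boundedness of Q(y) e^(-y) for Q = X^2 P, taken at y = 1/x. *)
Lemma flat_exp_quad P : exists c, forall x, `|flat_exp P x| <= c * x ^+ 2.
Proof.
have [c Pc] := horner_expR_bounded ('X^2 * P).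
exists `|c| => x; rewrite /flat_exp; case: ifPn => x0; last first.
  by rewrite normr0 mulr_ge0// sqr_ge0.
have xV0 : 0 <= x^-1 by rewrite invr_ge0 ltW.
rewrite -ler_pdivrMr ?exprn_gt0// (le_trans _ (ler_norm _))//.
apply: le_trans (Pc _ xV0).
rewrite hornerM hornerXn !normrM (ger0_norm (expR_ge0 _)).
rewrite (ger0_norm xV0) le_eqVlt; apply/orP; left; apply/eqP.
by field; rewrite gt_eqF.
Qed.

Lemma is_derive_flat_exp P x :
  is_derive x 1 (flat_exp P) (flat_exp (flat_exp_next P) x).
Proof.
have [x0|x0|->] := ltgtP x 0.
- apply: (@near_eq_is_derive _ _ _ (cst 0)).
  + near=> y; rewrite /flat_exp ifF//; apply/negbTE; rewrite -leNgt ltW//.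
    by near: y; exact: lt_nbhsl.
  + by rewrite /flat_exp ltNge (ltW x0)/=; exact: is_derive_cst.
- apply: (@near_eq_is_derive _ _ _ (fun y => P.[y^-1] * expR (- y^-1))).
  + near=> y; rewrite /flat_exp ifT//.
    by near: y; exact: lt_nbhsr.
  + have x0' : x != 0 by rewrite gt_eqF.
    have dV : is_derive x 1 (fun y : R => y^-1) (- x ^- 2 *: 1).
      exact: (@is_deriveV _ id x 1 1).
    have dP := @is_derive1_comp _ (horner P) _ x _ _ (is_derive_poly P x^-1) dV.
    have dE := @is_derive1_comp _ expR (fun y : R => - y^-1) x _ _
      (is_derive_expR (- x^-1)) (is_deriveN dV).
    apply: is_derive_eq (is_deriveM dP dE) _.
    rewrite /flat_exp x0 /flat_exp_next hornerM hornerXn hornerD hornerN /= /GRing.scale/=.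
    by rewrite exprVn; ring.
- have [c cP] := flat_exp_quad P; have [c' cP'] := flat_exp_quad (flat_exp_next P).
  have F0 Q : flat_exp Q 0 = 0 by rewrite /flat_exp ltxx.
  rewrite F0; apply: is_derive_cvg; apply/cvgr0Pnorm_le => e e0.
  have k0 : 0 < e / (`|c| + 1) by rewrite divr_gt0// ltr_wpDl.
  near=> h; have h0 : h != 0 by near: h; exact: nbhs_dnbhs_neq.
  rewrite /= F0 subr0 addr0 /GRing.scale/= mulr1 normrM normfV.
  rewrite mulrC ler_pdivrMr ?normr_gt0// (le_trans (cP h))//.
  rewrite -real_normK ?num_real// expr2 mulrA ler_wpM2r//.
  apply: (@le_trans _ _ ((`|c| + 1) * `|h|)).
    by rewrite ler_wpM2r// (le_trans (ler_norm c))// lerDl.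
  rewrite mulrC -ler_pdivlMr ?ltr_wpDl//.
  near: h; apply: dnbhs0_le; exact: k0.
Unshelve. all: by end_near. Qed.

End flat_exponential.

Section smooth_line.
Context {R : realType}.
Implicit Types (f g : R -> R) (P : {poly R}) (s c : R).

Fixpoint diffn (k : nat) f : Prop :=
  if k is k'.+1 then (forall x, derivable f x 1) /\ diffn k' (derive1 f) else True.

Lemma diffnW k f : diffn k.+1 f -> diffn k f.
Proof. by elim: k f => // k IH f [fd /IH]. Qed.

Lemma diffnS k f (f' : R -> R) : (forall x : R, is_derive x 1 f (f' x)) ->
  diffn k f' -> diffn k.+1 f.
Proof.
move=> ff' kf'; split; first by move=> x; have [] := ff' x.
suff -> : derive1 f = f' by [].
by apply/funext => x; rewrite derive1E; have [] := ff' x.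
Qed.

Lemma diffnP k f (x : R) : diffn k.+1 f -> is_derive x 1 f (derive1 f x).
Proof. by move=> [fd _]; rewrite derive1E; exact: derivableP. Qed.

Lemma diffnD k f g : diffn k f -> diffn k g -> diffn k (fun x => f x + g x).
Proof.
elim: k f g => // k IH f g kf kg.
apply: (@diffnS _ _ (fun x => derive1 f x + derive1 g x)).
  by move=> x; apply: is_deriveD; apply: diffnP; eassumption.
by apply: IH; [case: kf|case: kg].
Qed.

Lemma diffnM k f g : diffn k f -> diffn k g -> diffn k (fun x => f x * g x).
Proof.
elim: k f g => // k IH f g kf kg.
apply: (@diffnS _ _ (fun x => f x * derive1 g x + g x * derive1 f x)).
  by move=> x; apply: is_deriveM; apply: diffnP; eassumption.
by apply: diffnD; apply: IH; try exact: diffnW; [case: kg|case: kf].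
Qed.

Lemma diffn_flat_exp k P s c : diffn k (fun x => flat_exp P (s * x + c)).
Proof.
(* The factor [a] absorbs the powers of [s] produced by the chain rule, so that the induction
   closes. *)
suff H a : diffn k (fun x => a * flat_exp P (s * x + c)).
  by under [X in diffn _ X]eq_fun do rewrite -[flat_exp _ _]mul1r; exact: H.
elim: k P a => // k IH P a.
apply: (@diffnS _ _ (fun x => (a * s) * flat_exp (flat_exp_next P) (s * x + c)));
  last exact: IH.
move=> x.
have d1 : is_derive x 1 (fun x : R => s * x + c) s.
  apply: is_derive_eq (is_deriveD (is_deriveZ s (is_derive_id x 1)) (is_derive_cst c x 1)) _.
  by rewrite /GRing.scale/= mulr1 addr0.
have := @is_derive1_comp _ (flat_exp P) (fun x => s * x + c) x _ _
  (is_derive_flat_exp P (s * x + c)) d1.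
move=> /(is_deriveZ a) H; apply: is_derive_eq H _.
by rewrite /GRing.scale/=; ring.
Qed.

End smooth_line.

Section bumps.
Context {R : realType} {n : nat}.
Implicit Types (beta : 'I_n -> R -> R) (x : 'rV[R]_n).

(** A partial derivative of such a product only replaces one factor by its derivative, so smoothness
    in n variables reduces to one variable. *)
Definition prod_fun beta x : R := \prod_k beta k (x ord0 k).

Lemma is_derive_prod_fun beta x p : (forall y, derivable (beta p) y 1) ->
  is_derive x (unit_rV R p) (prod_fun beta)
    (prod_fun (fun k => if k == p then derive1 (beta k) else beta k) x).
Proof.
move=> bd; apply: is_derive_cvg.
pose c := \prod_(k | k != p) beta k (x ord0 k).
have -> : prod_fun (fun k => if k == p then derive1 (beta k) else beta k) x =
    c * 'D_1 (beta p) (x ord0 p).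
  rewrite /prod_fun (bigD1 p)//= eqxx derive1E mulrC; congr (_ * _).
  by apply: eq_bigr => k /negbTE ->.
have -> : (fun h => h^-1 *: ((prod_fun beta \o shift x) (h *: unit_rV R p) - prod_fun beta x)) =
   (fun h => c * (h^-1 *: ((beta p \o shift (x ord0 p)) (h *: 1) - beta p (x ord0 p)))).
  apply/funext => h; rewrite /= /prod_fun (bigD1 p)//= [X in _ - X](bigD1 p)//=.
  rewrite !mxE !eqxx !mulr1n.
  have -> : \prod_(k | k != p) beta k ((h *: unit_rV R p + x) ord0 k) = c.
    by apply: eq_bigr => k kp; rewrite !mxE (negbTE kp) mulr0 add0r.
  by rewrite -/c /GRing.scale/= mulr1; ring.
by apply: cvgMl_tmp; exact: bd.
Qed.

Lemma continuous_prod_fun beta : (forall k y, derivable (beta k) y 1) ->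
  continuous (prod_fun beta).
Proof.
move=> bd; apply: continuous_big => [|k _ x].
  by move=> z; exact: mul_continuous.
apply: (@continuous_comp _ _ _ (fun x => x ord0 k) (beta k)); first exact: coord_continuous.
by apply/differentiable_continuous/derivable1_diffP.
Qed.

Lemma smooth_prod_fun beta : (forall m k, diffn m (beta k)) -> smooth (prod_fun beta).
Proof.
move=> bs s /=.
suff [b' [b's ->]] : exists b', (forall m k, diffn m (b' k)) /\
    foldr (@partial R n) (prod_fun beta) s = prod_fun b'.
  split; first by apply: continuous_prod_fun => k; have [] := b's 1%N k.
  by move=> p x; apply: ex_derive; apply: is_derive_prod_fun; have [] := b's 1%N p.
elim: s => [|p s [b' [b's IH]]]; first by exists beta.
exists (fun k => if k == p then derive1 (b' k) else b' k); split.
  by move=> m k; case: ifPn => // _; have [] := b's m.+1 k.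
apply/funext => x; rewrite /= IH /partial; apply: derive_val.
by apply: is_derive_prod_fun; have [] := b's 1%N p.
Qed.

Definition open_box (a b : 'I_n -> R) : set 'rV[R]_n :=
  [set x | forall k, a k < x ord0 k < b k].
Definition closed_box (a b : 'I_n -> R) : set 'rV[R]_n :=
  [set x | forall k, a k <= x ord0 k <= b k].

(** Each factor is exp(-1/((N+1)(y-a))) exp(-1/((N+1)(b-y))) inside the interval: the growing scale
    pushes it to 1 there, while it stays 0 outside. The arguments are written as s y + c to fit
    [diffn_flat_exp]. *)
Definition bump (a b : 'I_n -> R) (N : nat) : 'rV[R]_n -> R :=
  prod_fun (fun k y => flat_exp 1 (N.+1%:R * y + - (N.+1%:R * a k)) *
                       flat_exp 1 (- N.+1%:R * y + N.+1%:R * b k)).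

Let bump_argl (c y z : R) : c * y + - (c * z) = c * (y - z).
Proof. by ring. Qed.

Let bump_argr (c y z : R) : - c * y + c * z = c * (z - y).
Proof. by ring. Qed.

Lemma smooth_bump a b N : smooth (bump a b N).
Proof.
by apply: smooth_prod_fun => m k; apply: diffnM; exact: diffn_flat_exp.
Qed.

Lemma flat_exp1_bound (y : R) : 0 <= flat_exp 1 y <= 1.
Proof.
rewrite /flat_exp; case: ifPn => [y0|_]; last by rewrite lexx ler01.
by rewrite hornerE mul1r expR_ge0 -expR0 ler_expR oppr_le0 invr_ge0 ltW.
Qed.

Lemma bump_bound a b N x : `|bump a b N x| <= 1.
Proof.
rewrite ger0_norm; last first.
  by apply: prodr_ge0 => k _; rewrite mulr_ge0//;
    [case/andP: (flat_exp1_bound (N.+1%:R * x ord0 k + - (N.+1%:R * a k)))|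
     case/andP: (flat_exp1_bound (- N.+1%:R * x ord0 k + N.+1%:R * b k))].
rewrite [leRHS](_ : 1 = \prod_(k < n) (1 : R)); last by rewrite big1.
apply: ler_prod => k _.
have /andP[u0 u1] := flat_exp1_bound (N.+1%:R * x ord0 k + - (N.+1%:R * a k)).
have /andP[v0 v1] := flat_exp1_bound (- N.+1%:R * x ord0 k + N.+1%:R * b k).
by rewrite mulr_ge0//= mulr_ile1.
Qed.

Lemma bump0 a b N x : ~ open_box a b x -> bump a b N x = 0.
Proof.
move=> /existsNP[k /negP kx]; apply/eqP; rewrite prodf_seq_eq0.
apply/hasP; exists k; first by rewrite mem_index_enum.
rewrite /= bump_argl bump_argr /flat_exp !pmulr_rgt0// !subr_gt0.
move: kx; rewrite negb_and => /orP[/negbTE ->|/negbTE ->].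
  by rewrite mul0r.
by rewrite mulr0.
Qed.

Lemma cvg_flat_exp (y : R) : 0 < y -> flat_exp 1 (N.+1%:R * y) @[N --> \oo] --> (1 : R).
Proof.
move=> y0; rewrite -[X in _ --> X]expR0 -[X in expR X]oppr0.
under eq_cvg do rewrite /flat_exp mulr_gt0// hornerE mul1r invfM.
apply: cvg_comp; last exact: continuous_expR.
apply: cvgN; rewrite -(mul0r y^-1); apply: cvgMr_tmp.
exact: (@cvg_harmonic R).
Qed.

Lemma cvg_bump a b x : bump a b N x @[N --> \oo] --> (\1_(open_box a b) x : R).
Proof.
rewrite indicE; case: (pselect (open_box a b x)) => xab; last first.
  rewrite memNset//; under eq_cvg do rewrite bump0//; exact: cvg_cst.
rewrite mem_set//=.
rewrite [X in _ --> X](_ : _ = \prod_(k < n) (1 : R)); last by rewrite big1.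
apply: cvg_big => [|k _]; first by move=> z; exact: mul_continuous.
rewrite -[X in _ --> X]mulr1.
have /andP[ax xb] := xab k.
apply: cvgM.
  under eq_cvg do rewrite bump_argl; apply: cvg_flat_exp; by rewrite subr_gt0.
under eq_cvg do rewrite bump_argr; apply: cvg_flat_exp; by rewrite subr_gt0.
Qed.

Lemma compact_closed_box a b : compact (closed_box a b).
Proof.
have := @rV_compact R n (fun k => `[a k, b k]%classic) (fun k => @segment_compact R (a k) (b k)).
congr compact; apply/seteqP; split => x /= xab k; have := xab k; rewrite in_itv//=.
Qed.

Lemma test_function_bump (Omega : set 'rV[R]_n) a b N :
  closed_box a b `<=` Omega -> test_function Omega (bump a b N).
Proof.
move=> abO; split; first exact: smooth_bump.
exists (closed_box a b); split => //; first exact: compact_closed_box.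
move=> x xab; apply: bump0 => xab'; apply: xab => k.
by have /andP[/ltW -> /ltW ->] := xab' k.
Qed.

End bumps.

(** * Uniqueness of weak derivatives *)

Section fundamental_lemma.
Context {R : realType} {n : nat}.
Local Notation mu := (@lebesgue_rV R n).
Implicit Types (F g h u : 'rV[R]_n -> R) (O : set 'rV[R]_n).

Definition octant (a : 'I_n -> R) : set 'rV[R]_n := [set x | forall k, a k < x ord0 k].

(** A half-space bounding one coordinate from below is the union over m of the octants whose other
    bounds are -m. Octants are wanted because they form a pi-system and cut a sup-norm ball in an
    open box. *)
Lemma measurable_rV_octants :
  @measurable _ 'rV[R]_n = <<s range octant >>.
Proof.
apply/seteqP; split; last first.
  apply: smallest_sub; first exact: sigma_algebra_measurable.
  move=> _ [a _ <-].
  apply: (measurable_forall_coord (S := fun i => [set y | a i < y])) => i.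
  by rewrite (_ : mkset _ = `]a i, +oo[%classic)// set_itvE.
pose T := g_sigma_algebraType (range octant).
have mc i : measurable_fun [set: T] (fun x : T => (x : 'rV[R]_n) ord0 i).
  apply: (measurability _ (RGenOInfty.measurableE R)) => //.
  move=> _ [_ [x ->] <-]; rewrite setTI.
  have -> : (fun y : T => (y : 'rV[R]_n) ord0 i) @^-1` `]x, +oo[ =
      \bigcup_m octant (fun k => if k == i then x else - m%:R).
    apply/seteqP; split => y /=.
      rewrite in_itv/= andbT => xy.
      exists (Num.trunc `|y : 'rV[R]_n|).+1 => // k.
      case: eqP => [->//|_]; rewrite ltrNl.
      apply: (@le_lt_trans _ _ `|y : 'rV[R]_n|).
        by rewrite (le_trans (ler_norm _))// normrN coord_le_norm.
      exact: truncnS_gt.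
    by move=> [m _ /(_ i)]; rewrite eqxx in_itv/= andbT.
  apply: bigcupT_measurable => m; apply: sub_sigma_algebra.
  by eexists.
apply: smallest_sub; first exact: smallest_sigma_algebra.
move=> B; rewrite -bigcup_seq => -[i _ [C mC <-]].
exact: mc.
Qed.

Lemma octantI a b : octant a `&` octant b = octant (fun k => Num.max (a k) (b k)).
Proof.
apply/seteqP; split => x /=.
  by move=> [xa xb] k; rewrite gt_max xa xb.
by move=> xab; split => k; have := xab k; rewrite gt_max => /andP[].
Qed.

Lemma measurable_open_box (a b : 'I_n -> R) : measurable (open_box a b).
Proof.
apply: (measurable_forall_coord (S := fun k => [set y | a k < y < b k])) => k.
by rewrite (_ : mkset _ = `]a k, b k[%classic)//.
Qed.

Section du_bois_reymond.
Context (O : set 'rV[R]_n) (F : 'rV[R]_n -> R).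
Hypothesis oO : open O.
Hypothesis iF : mu.-integrable setT (EFin \o F).
Hypothesis F0 : forall psi, test_function O psi -> \int[mu]_x (F x * psi x) = 0.

Let mF : measurable_fun setT F.
Proof. by have := measurable_int _ iF; move/measurable_EFinP. Qed.

(** The bumps of the box are test functions with values in [0, 1] that tend to its indicator, so
    dominated convergence applies with bound |F|. *)
Let integral_open_box a b : closed_box a b `<=` O ->
  (\int[mu]_(x in open_box a b) (F x)%:E = 0)%E.
Proof.
move=> abO; pose G N x := (F x * bump a b N x)%:E.
have mb N : measurable_fun setT (bump a b N).
  by apply: continuous_measurable_rV; exact: (smooth_bump a b N [::]).1.
have G0 N : (\int[mu]_x G N x = 0)%E.
  have iG : mu.-integrable setT (G N).
    apply: le_integrable iF => //; first by apply/measurable_EFinP; exact: measurable_funM.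
    by move=> x _; rewrite /= lee_fin normrM ler_piMr// bump_bound.
  rewrite -[LHS]fineK ?integrable_fin_num//; congr EFin.
  by apply: F0; exact: test_function_bump.
have mbox := measurable_open_box a b.
have [|||||_ _ cvgG] := @dominated_convergence _ _ R mu setT measurableT
    G (EFin \o (fun x => F x * \1_(open_box a b) x)) (abse \o (EFin \o F)).
- by move=> N; apply/measurable_EFinP; exact: measurable_funM.
- by apply/measurable_EFinP; apply: measurable_funM => //; exact: measurable_indic.
- apply: aeW => x _; apply: cvg_EFin; first exact: nearW.
  by apply: cvgMl_tmp; exact: cvg_bump.
- exact: integrable_abse.
- by apply: aeW => x N _ /=; rewrite lee_fin normrM ler_piMr// bump_bound.
have E : (\int[mu]_x (F x * \1_(open_box a b) x)%:E = 0)%E.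
  have /cvg_lim <- := cvgG; last by [].
  under eq_fun do rewrite G0.
  exact: lim_cst.
rewrite integral_mkcond -[RHS]E; apply: eq_integral => x _.
rewrite patchE indicE; case: ifPn => _; by rewrite ?mulr1 ?mulr0.
Qed.

(** The integral of [F] vanishes on the trace of every octant, which is an open box with closure in
    [O]. Dynkin induction extends this to every measurable part of the ball, which forces [F] to
    vanish almost everywhere on it. *)
Let ae0_ball c r : ball c (2 * r) `<=` O -> ae_eq mu (ball c r) (EFin \o F) (cst 0%E).
Proof.
move=> crO; have [r0|r0] := leP r 0.
  by apply: aeW => x [/lt_geF]; rewrite r0.
have mQ := @measurable_ball_rV R n c r.
pose P A := (\int[mu]_(x in ball c r `&` A) (F x)%:E = 0)%E.
have boxO (a : 'I_n -> R) :
    closed_box (fun k => Num.max (a k) (c ord0 k - r)) (fun k => c ord0 k + r) `<=` O.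
  move=> x xa; apply: crO; split; first by rewrite mulr_gt0.
  move=> i k; rewrite (ord1 i) /ball/= distrC; have /andP[] := xa k.
  rewrite ge_max => /andP[_ x1] x2.
  apply: (@le_lt_trans _ _ r); last by rewrite ltr_pMl// ltr1n.
  by rewrite ler_distl x1 x2.
have ballE (a : 'I_n -> R) : ball c r `&` octant a =
    open_box (fun k => Num.max (a k) (c ord0 k - r)) (fun k => c ord0 k + r).
  apply/seteqP; split => x.
    move=> [[_ cx] ax] k; have := cx ord0 k; rewrite /ball/= distrC ltr_distl => /andP[x1 x2].
    by rewrite gt_max ax x1 x2.
  move=> xa; split; last by move=> k; have /andP[] := xa k; rewrite gt_max => /andP[].
  split=> // i k; rewrite (ord1 i) /ball/= distrC ltr_distl.
  by have /andP[] := xa k; rewrite gt_max => /andP[_ ->] ->.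
have PO a : P (octant a) by rewrite /P ballE; exact: integral_open_box.
have PT : P setT.
  have := PO (fun k => c ord0 k - r); rewrite /P; congr ((integral _ _ _) = _).
  rewrite setIT; apply: setIidl => x [_ cx] k.
  by have := cx ord0 k; rewrite /ball/= distrC ltr_distl => /andP[].
have PA A : measurable A -> P A.
  move=> mA; apply: (dynkin_induction measurable_rV_octants) => //.
  - by move=> _ _ [a _ <-] [b _ <-]; rewrite octantI; eexists.
  - by move=> _ [a _ <-].
  - move=> S mS PS; move: PT; rewrite /P -{1}(setUv S) setIUr.
    rewrite integral_setU//; last 4 first.
    + exact: measurableI.
    + by apply: measurableI => //; exact: measurableC.
    + exact/measurable_EFinP/measurable_funTS.
    + by apply/disj_setPS => x [[_ Sx] [_ /(_ Sx)]].
    by rewrite PS add0e.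
  - move=> B mB tB PB; rewrite /P setI_bigcupr integral_bigcup//.
    + by apply: eseries0 => k _ _; exact: PB.
    + exact: trivIset_setIl.
    + by move=> k; exact: measurableI.
    + apply: integrableS iF => //; apply: bigcupT_measurable => k; exact: measurableI.
  - by rewrite -measurable_rV_octants.
apply: integral_ae_eq => //.
- exact: integrableS iF.
- move=> E EQ mE; rewrite integral0; have := PA _ mE.
  by rewrite /P setIidr.
Qed.

Lemma du_bois_reymond : {ae mu, forall x, O x -> F x = 0}.
Proof.
have [c [r [crO Ocr]]] := open_rV_cover oO.
have := ae_foralln (fun k => ae0_ball (crO k)).
apply: filterS => x xF /Ocr[k _ xk]; have := xF k xk.
by case.
Qed.

End du_bois_reymond.

Lemma L2_measurable O g : L2 O g -> measurable_fun setT (g \_ O).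
Proof. by rewrite /L2 inE => /andP[]; rewrite inE. Qed.

(** On a bounded set, |g| is dominated by the integrable function 1 + g^2. *)
Lemma L2_integrable O g : measurable O -> bounded_set O -> L2 O g ->
  mu.-integrable setT (EFin \o (g \_ O)).
Proof.
move=> mO /bounded_set_cube[M OM] g2.
have OM1 : O `<=` cube (M + 1) by apply: OM; rewrite ltrDl.
have i1 := integrable_cube (R := R) (n := n) 1 (M + 1).
have i2 := Lfun2_integrable_sqr g2.
apply: le_integrable (integrableD measurableT i1 i2) => //.
  by apply/measurable_EFinP; exact: L2_measurable.
move=> x _ /=; rewrite lee_fin mul1r indicE !patchE; case: ifPn => xO; last first.
  by rewrite normr0.
have -> : (x \in cube (M + 1)) = true by apply/mem_set/OM1/set_mem.
rewrite [leRHS]ger0_norm ?addr_ge0 ?sqr_ge0//= mulr1n -(real_normK (num_real (g x))).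
have := sqr_ge0 (`|g x| - 1).
have := normr_ge0 (g x); nra.
Qed.

Lemma test_function_bmfun O psi : test_function O psi -> bmfun psi.
Proof.
move=> [spsi [K [cK _ K0]]]; apply: compact_supp_bmfun cK K0.
exact: (spsi [::]).1.
Qed.

Lemma weak_partial_unique O p u g h : open O -> bounded_set O ->
  is_weak_partial O p u g -> is_weak_partial O p u h ->
  {ae mu, forall x, O x -> g x = h x}.
Proof.
move=> oO bO [g2 ug] [h2 uh].
have mO : measurable O := open_measurable_rV oO.
have ig := L2_integrable mO bO g2.
have ih := L2_integrable mO bO h2.
have igh : mu.-integrable setT (EFin \o (fun x => (g \_ O) x - (h \_ O) x)).
  exact: (integrableB measurableT ig ih).
have H psi : test_function O psi ->
    \int[mu]_x (((g \_ O) x - (h \_ O) x) * psi x) = 0.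
  move=> tpsi.
  have cpsi : continuous psi := (tpsi.1 [::]).1.
  have mpsi := continuous_measurable_rV cpsi.
  have [M _ psiM] := bmfun_bounded (test_function_bmfun tpsi).
  have im f : mu.-integrable setT (EFin \o f) ->
      mu.-integrable setT (EFin \o (fun x => f x * psi x)).
    move=> jf; apply: le_integrable (integrableZl measurableT M jf) => //.
      apply/measurable_EFinP; apply: measurable_funM => //.
      by have := measurable_int _ jf => /measurable_EFinP.
    move=> x _ /=; rewrite lee_fin !normrM mulrC ler_wpM2r//.
    exact: le_trans (psiM x) (ler_norm M).
  transitivity (\int[mu]_x ((g \_ O) x * psi x) - \int[mu]_x ((h \_ O) x * psi x)).
    by rewrite -RintegralB//; [apply: eq_Rintegral => x _; rewrite mulrBl|exact: im..].
  have e (f : 'rV[R]_n -> R) : \int[mu]_x ((f \_ O) x * psi x) = \int[mu]_(x in O) (f x * psi x).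
    rewrite [RHS]Rintegral_mkcond; apply: eq_Rintegral => x _; rewrite !patchE.
    by case: ifPn => // _; rewrite mul0r.
  rewrite !e; have := ug _ tpsi; rewrite uh// => /oppr_inj ->; exact: subrr.
have := du_bois_reymond oO igh H; apply: filterS => x xgh Ox.
by have := xgh Ox; rewrite !patchE mem_set//= => /eqP; rewrite subr_eq0 => /eqP.
Qed.

End fundamental_lemma.

(** * Simplices and barycentric coordinates *)

Section barycentric.
Context {R : realType} {d : nat} {I : finType}.
Variables (v : I -> 'rV[R]_d) (A : {set I}).
Implicit Types (x y z : 'rV[R]_d) (k : I).

(** Each row is a vertex followed by 1, so affine independence of the vertices is linear
    independence of the rows, and the barycentric coordinates of x are the w with w M = (x, 1). The
    pseudo-inverse avoids a cast: #|A| = d + 1 holds only propositionally. *)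
Definition simplex_mx : 'M[R]_(#|A|, d + 1) := \matrix_i row_mx (v (enum_val i)) 1%:M.

(** The sum has exactly one term for [k] in [A] and none otherwise; this inverts [enum_val] and
    extends the coordinates by 0 to all other indices. *)
Definition bary_coef k (q : 'I_(d + 1)) : R :=
  \sum_(i < #|A| | enum_val i == k) pinvmx simplex_mx q i.

Definition bary_grad k (p : 'I_d) : R := bary_coef k (lshift 1 p).

(* The affine function equal to 1 at vertex [k] and 0 at the others; it vanishes
   identically when [k] is not in [A]. *)
Definition bary k x : R :=
  \sum_p bary_grad k p * x ord0 p + bary_coef k (rshift d ord0).

Lemma bary_notin k x : k \notin A -> bary k x = 0.
Proof.
move=> kA; have c0 q : bary_coef k q = 0.
  by rewrite /bary_coef big1// => i /eqP ik; move: kA; rewrite -ik enum_valP.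
by rewrite /bary c0 big1 ?addr0// => p _; rewrite /bary_grad c0 mul0r.
Qed.

Lemma bary_affine k a x y : bary k (a *: x + (1 - a) *: y) = a * bary k x + (1 - a) * bary k y.
Proof.
rewrite /bary.
have -> : \sum_p bary_grad k p * (a *: x + (1 - a) *: y) ord0 p =
    a * (\sum_p bary_grad k p * x ord0 p) + (1 - a) * (\sum_p bary_grad k p * y ord0 p).
  by rewrite !mulr_sumr -big_split; apply: eq_bigr => p _; rewrite !mxE/=; ring.
ring.
Qed.

Lemma bary_shift k x p (t : R) : bary k (x + t *: unit_rV R p) = bary k x + t * bary_grad k p.
Proof.
rewrite /bary addrAC; congr (_ + _).
under eq_bigr do rewrite !mxE mulrDr.
rewrite big_split/=; congr (_ + _).
rewrite (bigD1 p)//= big1; first by rewrite eqxx/= mulr1 addr0 mulrC.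
by move=> q /negbTE ->; rewrite !mulr0.
Qed.

Lemma continuous_bary k : continuous (bary k).
Proof.
have c1 : continuous (fun x : 'rV[R]_d => \sum_p bary_grad k p * x ord0 p).
  apply: continuous_big => [|p _ x]; first by move=> z; exact: add_continuous.
  exact: (cvgMl_tmp (@coord_continuous R 1 d ord0 p x)).
by move=> x; exact: (cvgD (c1 x) (cvg_cst _)).
Qed.

Hypothesis cardA : #|A| = d.+1.
Hypothesis indA : affinely_independent v A.

Let sum_enum_val (V : nmodType) (F : I -> V) : \sum_(k in A) F k = \sum_(i < #|A|) F (enum_val i).
Proof. by rewrite big_enum_val. Qed.

Lemma simplex_mx_full : row_full simplex_mx.
Proof.
have: row_free simplex_mx.
  apply: inj_row_free => u u0.
  pose w k := \sum_(i < #|A| | enum_val i == k) u ord0 i.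
  have wE i : w (enum_val i) = u ord0 i.
    rewrite /w (bigD1 i)//= big1 ?addr0// => j /andP[/eqP/enum_val_inj ->].
    by rewrite eqxx.
  have uM q : \sum_(i < #|A|) u ord0 i * simplex_mx i q = 0.
    by have := congr1 (fun M : 'rV[R]_(d + 1) => M ord0 q) u0; rewrite !mxE.
  have w1 : \sum_(k in A) w k = 0.
    rewrite sum_enum_val -[RHS](uM (rshift d ord0)); apply: eq_bigr => i _.
    by rewrite wE mxE row_mxEr mxE eqxx mulr1.
  have wv : \sum_(k in A) w k *: v k = 0.
    apply/rowP => p; rewrite sum_enum_val summxE mxE -[RHS](uM (lshift 1 p)).
    by apply: eq_bigr => i _; rewrite wE [LHS]mxE [in RHS]mxE row_mxEl.
  apply/rowP => i; rewrite mxE -wE; apply: indA => //; exact: enum_valP.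
rewrite /row_free /row_full => /eqP ->.
by rewrite cardA addn1.
Qed.

Let bary_mulmx x i : bary (enum_val i) x = (row_mx x 1%:M *m pinvmx simplex_mx) ord0 i.
Proof.
rewrite mxE big_split_ord/= big_ord1 !row_mxEr mxE eqxx mul1r.
have bc q : bary_coef (enum_val i) q = pinvmx simplex_mx q i.
  rewrite /bary_coef (bigD1 i)//= big1 ?addr0// => j /andP[/eqP/enum_val_inj ->].
  by rewrite eqxx.
rewrite /bary bc; congr (_ + _); apply: eq_bigr => p _.
by rewrite row_mxEl /bary_grad bc mulrC.
Qed.

Let bary_row x q :
  \sum_(i < #|A|) bary (enum_val i) x * simplex_mx i q =
  (row_mx x 1%:M : 'rV[R]_(d + 1)) ord0 q.
Proof.
rewrite -[in RHS](mulmx1 (row_mx x 1%:M)) -(mulVpmx simplex_mx_full) mulmxA mxE.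
by apply: eq_bigr => i _; rewrite bary_mulmx.
Qed.

Lemma bary_sum x : \sum_(k in A) bary k x = 1.
Proof.
have := bary_row x (rshift d ord0); rewrite row_mxEr mxE eqxx mulr1n => <-.
by rewrite sum_enum_val; apply: eq_bigr => i _; rewrite mxE row_mxEr mxE eqxx mulr1.
Qed.

Lemma bary_comb x : \sum_(k in A) bary k x *: v k = x.
Proof.
apply/rowP => p; have := bary_row x (lshift 1 p); rewrite row_mxEl => <-.
rewrite sum_enum_val summxE; apply: eq_bigr => i _.
by rewrite [LHS]mxE [in RHS]mxE row_mxEl.
Qed.

Lemma bary_uniq (w : I -> R) x k : \sum_(l in A) w l = 1 ->
  \sum_(l in A) w l *: v l = x -> k \in A -> bary k x = w k.
Proof.
move=> w1 wx kA; apply/eqP; rewrite -subr_eq0; apply/eqP.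
apply: (indA (w := fun k => bary k x - w k)) => //.
  by rewrite sumrB bary_sum w1 subrr.
under eq_bigr do rewrite scalerBl.
by rewrite sumrB bary_comb wx subrr.
Qed.

Lemma bary_vertex k l : k \in A -> l \in A -> bary k (v l) = (k == l)%:R.
Proof.
move=> kA lA; apply: (@bary_uniq (fun k => (k == l)%:R)) => //.
  by rewrite (bigD1 l)//= eqxx big1 ?addr0// => m /andP[_ /negbTE ->].
by rewrite (bigD1 l)//= eqxx scale1r big1 ?addr0// => m /andP[_ /negbTE ->]; rewrite scale0r.
Qed.

Lemma hullE : hull v A = [set x | forall k, k \in A -> 0 <= bary k x].
Proof.
apply/seteqP; split => x /=.
  by move=> [w [w0 w1 ->]] k kA; rewrite (@bary_uniq w)// w0.
by move=> b0; exists (fun k => bary k x); split => //; [rewrite bary_sum|rewrite bary_comb].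
Qed.

Lemma bary_face (B : {set I}) x k : B \subset A -> hull v B x -> k \notin B -> bary k x = 0.
Proof.
move=> BA [w [w0 w1 wx]] kB.
have [kA|] := boolP (k \in A); last exact: bary_notin.
pose w' l := if l \in B then w l else 0.
have sw (V : nmodType) (F : I -> R -> V) : (forall l, F l 0 = 0) ->
    \sum_(l in A) F l (w' l) = \sum_(l in B) F l (w l).
  move=> F0; rewrite (big_setID B)/= (finset.setIidPr BA) [X in _ + X]big1 ?addr0.
    by apply: eq_bigr => l lB; rewrite /w' lB.
  by move=> l; rewrite inE /w' => /andP[/negbTE ->].
rewrite (@bary_uniq w')//; first by rewrite /w' (negbTE kB).
  by rewrite (sw _ (fun _ r => r)).
by rewrite wx (sw _ (fun l r => r *: v l))// => l; rewrite scale0r.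
Qed.

Definition open_simplex : set 'rV[R]_d := [set x | forall k, k \in A -> 0 < bary k x].

Lemma open_simplex_sub_hull : open_simplex `<=` hull v A.
Proof. by rewrite hullE => x xU k kA; exact/ltW/xU. Qed.

Lemma open_open_simplex : open open_simplex.
Proof.
have -> : open_simplex = \big[setI/setT]_(k in A) (bary k @^-1` [set r | 0 < r]).
  apply/seteqP; split => x.
    by move=> xU; rewrite -bigcap_seq_cond => k /= /andP[_ kA]; exact: xU.
  rewrite -bigcap_seq_cond => xU k kA; apply: xU.
  by rewrite /= mem_index_enum kA.
elim/big_ind: _ => [|B C|k _]; [exact: openT|exact: openI|].
apply: open_comp; last exact: open_gt.
by move=> x _; exact: continuous_bary.
Qed.

Lemma closed_hull : closed (hull v A).
Proof.
rewrite hullE.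
have -> : [set x | forall k, k \in A -> 0 <= bary k x] =
    \bigcap_(k in [set` A]) (bary k @^-1` [set r | 0 <= r]).
  by apply/seteqP; split => x xA k kA; exact: xA.
apply: closed_bigI => k _; apply: preimage_closed; last exact: closed_ge.
by move=> x _; exact: continuous_bary.
Qed.

Lemma bary_le1 x k : hull v A x -> k \in A -> bary k x <= 1.
Proof.
rewrite hullE => xA kA; rewrite -(bary_sum x) (bigD1 k)//= lerDl.
by apply: sumr_ge0 => l /andP[lA _]; exact: xA.
Qed.

Lemma hull_cube : hull v A `<=` cube (\sum_(k in A) `|v k|).
Proof.
move=> x xA i; rewrite -[in leLHS](bary_comb x) summxE.
rewrite (le_trans (ler_norm_sum _ _ _))// ler_sum// => k kA.
rewrite mxE normrM -[leRHS]mul1r ler_pM//.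
  rewrite ger0_norm ?bary_le1//.
  by move: xA; rewrite hullE; exact.
exact: coord_le_norm.
Qed.

Lemma measurable_open_simplex : measurable open_simplex.
Proof. apply: open_measurable_rV; exact: open_open_simplex. Qed.

Lemma measurable_hull : measurable (hull v A).
Proof.
rewrite -(setCK (hull _ _)); apply: measurableC; apply: open_measurable_rV.
by rewrite openC; exact: closed_hull.
Qed.

Lemma lebesgue_hull_fin : (lebesgue_rV (hull v A) < +oo)%E.
Proof.
apply: le_lt_trans (@lebesgue_rV_cube R d (\sum_(k in A) `|v k|)).
apply: le_measure; rewrite ?inE; [exact: measurable_hull|exact: measurable_cube|exact: hull_cube].
Qed.

(* A homothety of ratio [a < 1] about the barycentre maps the closed simplex
   into the open one, so the boundary has measure at most [(1 - a^d)] times that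
   of the simplex. *)
Lemma negligible_simplex_boundary : lebesgue_rV (hull v A `\` open_simplex) = 0%E.
Proof.
have mh := measurable_hull; have mU := measurable_open_simplex.
have Uh := open_simplex_sub_hull.
have hfin := lebesgue_hull_fin.
have hn : lebesgue_rV (hull v A) \is a fin_num by rewrite ge0_fin_numE.
have Un : lebesgue_rV open_simplex \is a fin_num.
  rewrite ge0_fin_numE//; apply: le_lt_trans hfin.
  by apply: le_measure; rewrite ?inE.
pose s : R := d.+1%:R^-1.
pose z : 'rV[R]_d := \sum_(k in A) s *: v k.
have zb k : k \in A -> bary k z = s.
  move=> kA; rewrite (@bary_uniq (fun=> s))// sumr_const cardA.
  by rewrite -[_ *+ _]mulr_natr mulVf.
have key (a : R) : 0 < a -> a < 1 ->
    a ^+ d * fine (lebesgue_rV (hull v A)) <= fine (lebesgue_rV open_simplex).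
  move=> a0 a1; rewrite -lee_fin EFinM !fineK//.
  rewrite -(lebesgue_rV_affine ((1 - a) *: z) a0 mU).
  apply: lee_wpmul2l; first by rewrite lee_fin exprn_ge0// ltW.
  apply: le_measure; rewrite ?inE//.
    by rewrite -[X in measurable X]setTI; apply: measurable_affine_rV.
  rewrite hullE => x xA k kA; rewrite bary_affine zb// ltr_wpDl//.
    by rewrite mulr_ge0// ?xA// ltW.
  by rewrite mulr_gt0// ?subr_gt0// invr_gt0.
have le_hU : fine (lebesgue_rV (hull v A)) <= fine (lebesgue_rV open_simplex).
  set m := fine _ in key *; set M := fine _ in key *.
  have cv : a ^+ d * m @[a --> (1:R)^'-] --> 1 ^+ d * m.
    apply: cvgMr_tmp; apply: cvg_at_left_filter.
    exact: exprn_continuous.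
  rewrite -[leLHS]mul1r -(expr1n _ d) -(cvg_lim _ cv)//.
  apply: limr_le; first exact: cvgP cv.
  near=> a; apply: key; last by near: a; exact: nbhs_left_lt.
  by near: a; apply: nbhs_left_gt; exact: ltr01.
rewrite measureD// setIidr// -[X in (X - _)%E](fineK hn) -[X in (_ - X)%E](fineK Un) -EFinB.
apply/eqP; rewrite eqe eq_le subr_le0 le_hU/= subr_ge0 fine_le//.
by apply: le_measure; rewrite ?inE.
Unshelve. all: by end_near. Qed.

End barycentric.

Section corner.
Context {R : realType} {d : nat} {I : finType}.
Variables (v : I -> 'rV[R]_d) (A : {set I}).
Hypothesis cardA : #|A| = d.+1.
Hypothesis indA : affinely_independent v A.
Local Notation mu := (@lebesgue_rV R d).

Let bary_homothety (a : R) i k x : i \in A -> k \in A ->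
  bary v A k (a *: x + (1 - a) *: v i) = a * bary v A k x + (1 - a) * (k == i)%:R.
Proof. by move=> iA kA; rewrite bary_affine bary_vertex. Qed.

Lemma measurable_bary_lt k (c : R) : measurable [set x | c < bary v A k x].
Proof.
apply: open_measurable_rV; rewrite (_ : mkset _ = bary v A k @^-1` [set r | c < r])//.
by apply: open_comp; [move=> x _; exact: continuous_bary|exact: open_gt].
Qed.

Lemma measurable_bary_eq k (c : R) : measurable [set x | bary v A k x = c].
Proof.
rewrite -(setCK (mkset _)); apply: measurableC; apply: open_measurable_rV.
rewrite openC (_ : mkset _ = bary v A k @^-1` [set r | r = c])//.
by apply: preimage_closed; [move=> x _; exact: continuous_bary|exact: closed_eq].
Qed.

Definition corner i (a : R) : set 'rV[R]_d :=
  open_simplex v A `&` [set x | 1 - a < bary v A i x].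

Lemma measurable_corner i a : measurable (corner i a).
Proof. by apply: measurableI; [exact: measurable_open_simplex|exact: measurable_bary_lt]. Qed.

(** The homothety of ratio [a] about vertex [i] multiplies every barycentric coordinate by [a] and
    adds 1 - a to the one of [i]; the preimage of the corner is therefore the whole open simplex. *)
Lemma lebesgue_corner i (a : R) : i \in A -> 0 < a -> a <= 1 ->
  mu (corner i a) = ((a ^+ d)%:E * mu (open_simplex v A))%E.
Proof.
move=> iA a0 a1.
rewrite -(lebesgue_rV_affine ((1 - a) *: v i) a0 (measurable_corner i a)).
congr (_ * mu _)%E; apply/seteqP; split => x.
  move=> [/= xU xi] k kA; have := xU k kA; rewrite bary_homothety//.
  case: eqP => [ki _|ki]; last by rewrite mulr0 addr0 pmulr_rgt0.
  by move: xi; rewrite bary_homothety// eqxx mulr1 ltrDr pmulr_rgt0// ki.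
move=> xU; split => [k kA|] /=; rewrite bary_homothety//.
  by rewrite ltr_pwDl// ?mulr_gt0 ?xU// mulr_ge0// subr_ge0.
by rewrite eqxx mulr1 ltrDr mulr_gt0// xU.
Qed.

(** The same homothety pulls the slice back into the face opposite to vertex [i], which lies in the
    null boundary of the simplex. *)
Lemma negligible_slice i (a : R) : i \in A -> 0 < a -> a <= 1 ->
  mu (open_simplex v A `&` [set x | bary v A i x = 1 - a]) = 0%E.
Proof.
move=> iA a0 a1; set S := _ `&` _.
have mS : measurable S.
  by apply: measurableI; [exact: measurable_open_simplex|exact: measurable_bary_eq].
have := lebesgue_rV_affine ((1 - a) *: v i) a0 mS; set S' := (X in lebesgue_rV X) => <-.
have mS' : measurable S'.
  by rewrite -[X in measurable X]setTI; apply: measurable_affine_rV.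
suff -> : mu S' = 0%E by rewrite mule0.
have mB : measurable (hull v A `\` open_simplex v A).
  by apply: measurableD; [exact: measurable_hull|exact: measurable_open_simplex].
apply/eqP; rewrite eq_le measure_ge0 andbT.
rewrite -(negligible_simplex_boundary cardA indA).
apply: le_measure; rewrite ?inE// => x [/= xU].
rewrite bary_homothety// eqxx mulr1 => /eqP; rewrite -subr_eq0 addrK mulf_eq0.
rewrite gt_eqF//= => /eqP xi; split; last by move=> /(_ i iA); rewrite xi ltxx.
rewrite hullE// => k kA; have := xU k kA; rewrite bary_homothety//.
case: eqP => [-> _|_]; first by rewrite xi.
by rewrite mulr0 addr0 pmulr_rgt0// => /ltW.
Qed.

End corner.

(** * Finite closed covers, Lipschitz bounds along a segment, margins of compact sets *)

Lemma continuous_mx_coord {R : realType} {X : topologicalType} m n (f : X -> 'M[R]_(m, n)) (x : X) :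
  (forall i j, (fun y => f y i j) y @[y --> x] --> f x i j) -> f y @[y --> x] --> f x.
Proof.
move=> fc; apply/cvgrPdist_le => e e0.
have H : \forall y \near x, forall ij : 'I_m * 'I_n, `|f x ij.1 ij.2 - f y ij.1 ij.2| <= e.
  apply: filter_forall => ij; have /cvgrPdist_le := fc ij.1 ij.2; exact.
apply: filterS H => y H.
rewrite [leLHS]mx_normrE; apply/bigmax_leP; split; first exact: ltW.
by move=> ij _; rewrite !mxE; exact: H.
Qed.

Lemma near_finite_closed {X : topologicalType} {I : finType} (A : I -> set X) (s : X) :
  (forall a, closed (A a)) -> \forall u \near s, forall a, A a u -> A a s.
Proof.
move=> cA; have H a : \forall u \near s, A a u -> A a s.
  have [As|nAs] := pselect (A a s); first by apply: nearW => u.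
  have : nbhs s (~` A a) by apply: open_nbhs_nbhs; split => //; rewrite openC.
  by apply: filterS => u nAu /nAu.
exact: filter_forall H.
Qed.

Section line_lipschitz.
Context {R : realType} {I : finType}.

(** This avoids listing the pieces that a segment cuts out of a mesh. Let s be the supremum of the
    parameters where the bound holds. Near s, every parameter lies in a piece that also contains s,
    because the pieces are closed and finitely many; so the bound holds at s, and beyond s as long
    as s < t. *)
Lemma lipschitz_finite_closed_cover (f : R -> R) (A : I -> set R) (L t : R) :
  0 <= L -> 0 <= t -> (forall a, closed (A a)) ->
  (forall s, 0 <= s <= t -> exists a, A a s) ->
  (forall a s s', A a s -> A a s' -> `|f s - f s'| <= L * `|s - s'|) ->
  `|f t - f 0| <= L * t.
Proof.
move=> L0 t0 cA covA lipA.
pose S := [set s | 0 <= s <= t /\ `|f s - f 0| <= L * s].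
have S0 : S 0 by split; rewrite ?lexx ?t0// subrr normr0 mulr0.
have supS : has_sup S by split; [exists 0|exists t => s [/andP[_ ->]]].
pose s := sup S.
have s0 : 0 <= s by apply: ub_le_sup => //; case: supS.
have st : s <= t by apply: ge_sup; [exists 0|move=> u [/andP[_ ->]]].
have nearA := near_finite_closed s cA.
have /nbhs_ballP[e /= e0 He] := nearA.
have Ss : S s.
  split; first by rewrite s0 st.
  have [u Su us] := sup_adherent e0 supS.
  have us' : u <= s by apply: ub_le_sup => //; case: supS.
  have [u0t fu] := Su.
  have [a Aau] := covA u u0t.
  have bu : ball s e u by rewrite /ball/= ger0_norm ?subr_ge0// ltrBlDl -ltrBlDr.
  have := lipA a s u (He _ bu _ Aau) Aau; rewrite [X in L * X]ger0_norm ?subr_ge0// => h.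
  have -> : f s - f 0 = (f s - f u) + (f u - f 0) by ring.
  rewrite (le_trans (ler_normD _ _))//; nra.
have [ts|ts] := leP t s.
  have -> : t = s by apply/le_anti; rewrite ts st.
  by case: Ss.
pose u := Num.min t (s + e / 2).
have us : s < u by rewrite lt_min ts ltrDl divr_gt0.
have ut : u <= t by rewrite ge_min lexx.
have ue : u <= s + e / 2 by rewrite ge_min lexx orbT.
have bu : ball s e u.
  rewrite /ball/= distrC gtr0_norm ?subr_gt0//; lra.
have u0t : 0 <= u <= t by rewrite ut (le_trans s0)// ltW.
have [a Aau] := covA u u0t.
suff Su : S u by have := ub_le_sup supS.2 Su; rewrite leNgt us.
split => //; have [_ fs] := Ss.
have := lipA a u s Aau (He _ bu _ Aau); rewrite [X in L * X]gtr0_norm ?subr_gt0// => h.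
have -> : f u - f 0 = (f u - f s) + (f s - f 0) by ring.
rewrite (le_trans (ler_normD _ _))//; nra.
Qed.

End line_lipschitz.

Section compact_margin.
Context {R : realType} {n : nat}.

Lemma compact_ball_margin (K O : set 'rV[R]_n) : compact K -> open O -> K `<=` O ->
  exists2 t : R, 0 < t & forall x, K x -> ball x t `<=` O.
Proof.
move=> /compact_near_coveringP cK oO KO.
have H : \forall t \near (0 : R)^'+, K `<=` [set x | ball x t `<=` O].
  apply: cK => x Kx.
  have /nbhs_ballP[e /= e0 xeO] := open_nbhs_nbhs (conj oO (KO _ Kx)).
  exists (ball x (e / 2), [set t | t <= e / 2]) => /=.
    split; first by apply: nbhsx_ballx; rewrite divr_gt0.
    by apply: nbhs_right_le; rewrite divr_gt0.
  move=> [y t] /= [xy te] z yz; apply: xeO; rewrite (splitr e); apply: ball_triangle xy _.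
  exact: le_ball yz.
near (0 : R)^'+ => t; exists t => //.
by move=> x Kx; have := near H t; apply.
Unshelve. all: by end_near. Qed.

End compact_margin.

(** * Meshes and nodal functions *)

Lemma lipschitz_continuous {R : realType} {V W : normedModType R} (f : V -> W) :
  lipschitz f -> continuous f.
Proof.
move=> [M [_ fM]] x.
pose L := Num.max M 0 + 1.
have L0 : 0 < L by rewrite ltr_wpDl// le_max lexx orbT.
have ML : M < L by rewrite ltr_pwDr// le_max lexx.
have fL y z : `|f y - f z| <= L * `|y - z| by exact: (fM _ ML (y, z)).
apply/cvgrPdist_le => e e0; near=> y.
rewrite (le_trans (fL _ _))// mulrC -ler_pdivlMr//.
near: y; apply: cvgr_dist_le; first exact: cvg_id.
by rewrite divr_gt0.
Unshelve. all: by end_near. Qed.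

Section mesh_geometry.
Context {R : realType} {d : nat} (Omega : set 'rV[R]_d) (T : mesh R d).
Hypothesis hOmega : bounded_lipschitz_domain Omega.
Hypothesis hT : triangulation T Omega.
Local Notation mu := (@lebesgue_rV R d).
Implicit Types (a b : 'I_(n_cells T)) (j : 'I_(n_nodes T)) (p : 'I_d) (x : 'rV[R]_d).

Definition cell_interior a : set 'rV[R]_d := open_simplex (@node _ _ T) (cell_nodes a).

Definition cell_grad a j p : R := bary_grad (@node _ _ T) (cell_nodes a) j p.

Definition cell_bary a j x : R := bary (@node _ _ T) (cell_nodes a) j x.

Let card_cell a : #|cell_nodes a| = d.+1.
Proof. by case: hT => _ /(_ a)[]. Qed.

Let ind_cell a : affinely_independent (@node _ _ T) (cell_nodes a).
Proof. by case: hT => _ /(_ a)[]. Qed.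

Let closure_cells : closure Omega = \bigcup_a @cell _ _ T a.
Proof. by case: hT. Qed.

Let open_Omega : open Omega.
Proof. by case: hOmega. Qed.

Lemma cell_sub_closure a : cell a `<=` closure Omega.
Proof. by move=> x ax; rewrite closure_cells; exists a. Qed.

Lemma cell_interior_sub a : cell_interior a `<=` cell a.
Proof. by apply: open_simplex_sub_hull. Qed.

(** Conformity puts [x] in the face spanned by the shared vertices. Distinct cells have distinct
    vertex sets of equal size, so [a] has a vertex outside [b]; its coordinate vanishes on that face
    but is positive in the open cell. *)
Lemma cell_interior_disjoint a b x : cell_interior a x -> cell b x -> a = b.
Proof.
move=> xa xb; apply/eqP/contraT => ab.
have [[_ injc] _ _ _ conf] := hT.
have : hull (@node _ _ T) (cell_nodes a :&: cell_nodes b) x.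
  by rewrite -conf; split => //; exact: cell_interior_sub.
have [k ka kb] : exists2 k, k \in cell_nodes a & k \notin cell_nodes b.
  apply/subsetPn; apply: contra ab => sab; apply/eqP/injc/eqP.
  by rewrite eqEcard sab !card_cell leqnn.
move=> /(bary_face (card_cell a) (@ind_cell a) (subsetIl _ _)) => /(_ k).
rewrite inE ka/= => /(_ kb) k0.
by have := xa k ka; rewrite k0 ltxx.
Qed.

Lemma ae_cell_interior : {ae mu, forall x, closure Omega x -> exists a, cell_interior a x}.
Proof.
have H a : {ae mu, forall x, cell a x -> cell_interior a x}.
  exists (cell a `\` cell_interior a); split.
  - by apply: measurableD; [exact: measurable_hull|exact: measurable_open_simplex].
  - exact: negligible_simplex_boundary.
  - by move=> x /= /not_implyP[].
have : {ae mu, forall x, forall a, cell a x -> cell_interior a x} by exact: filter_forall H.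
by apply: filterS => x Hx; rewrite closure_cells => -[a _ /Hx]; exists a.
Qed.

(* A boundary point inside an open cell would have, just below the graph that
   describes [Omega], points of the cell that are not in the closure of [Omega]. *)
Lemma cell_interior_domain a : cell_interior a `<=` Omega.
Proof.
move=> x xa; apply: contrapT => nOx.
have clO y : cell_interior a y -> closure Omega y.
  by move=> /cell_interior_sub /cell_sub_closure.
have [_ _ _ _ /(_ x)] := hOmega.
case; first by split; [exact: clO|move=> /interior_subset].
move=> r [Q [k [gamma [r0 QQ gammaL OE]]]].
have xge : (x *m Q) ord0 k <= gamma (col' k (x *m Q)).
  rewrite leNgt; apply/negP => xlt; apply: nOx.
  have : (Omega `&` ball x r) x by rewrite OE; split => //; exact: ballxx.
  by case.
have gammac := lipschitz_continuous gammaL.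
pose e : 'rV[R]_d := unit_rV R k *m Q^T.
have eQ : e *m Q = unit_rV R k.
  by rewrite -mulmxA (mulmx1C QQ) mulmx1.
have [s s0 [sU sr]] : exists2 s : R, 0 < s & cell_interior a (x - s *: e) /\ ball x r (x - s *: e).
  have cont : x - s *: e @[s --> (0 : R)^'+] --> x.
    rewrite -[X in _ --> X]subr0 -(scale0r e); apply: cvgB; first exact: cvg_cst.
    by apply: cvgZr_tmp; exact: cvg_at_right_filter.
  have : nbhs x (cell_interior a `&` ball x r).
    apply: filterI; last exact: nbhsx_ballx.
    by apply: open_nbhs_nbhs; split => //; exact: open_open_simplex.
  move=> /cont H; near (0 : R)^'+ => s; exists s => //.
  by near: s; exact: H.
set y := x - s *: e in sU sr.
(* Moving along [e] changes only the distinguished rotated coordinate, so the graph height is the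
   same at [x] and [y] and [y] lies strictly below it. This is an open condition, yet [y] is a limit
   of points of [Omega]. *)
have D0 : 0 < gamma (col' k (y *m Q)) - (y *m Q) ord0 k.
  have yQ : y *m Q = x *m Q - s *: unit_rV R k by rewrite mulmxBl -scalemxAl eQ.
  have -> : col' k (y *m Q) = col' k (x *m Q).
    by apply/rowP => i; rewrite yQ !mxE /= eq_sym (negbTE (neq_lift k i)) mulr0 subr0.
  rewrite yQ !mxE !eqxx mulr1; have := xge; rewrite !mxE => xge'; lra.
have Dc : continuous (fun z : 'rV[R]_d => gamma (col' k (z *m Q)) - (z *m Q) ord0 k).
  have cm i : continuous (fun z : 'rV[R]_d => (z *m Q) ord0 i).
    rewrite (_ : (fun z : 'rV[R]_d => _) = fun z : 'rV[R]_d => \sum_p z ord0 p * Q p i); last first.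
      by apply/funext => z; rewrite mxE.
    apply: continuous_big => [|p _ z]; first by move=> w; exact: add_continuous.
    exact: (cvgMr_tmp (@coord_continuous R 1 d ord0 p z)).
  have cc : continuous (fun z : 'rV[R]_d => col' k (z *m Q)).
    move=> z; apply: continuous_mx_coord => i q; rewrite (ord1 i) mxE.
    rewrite (_ : (fun y : 'rV[R]_d => _) =
        fun y : 'rV[R]_d => (y *m Q) ord0 (lift k q)); last first.
      by apply/funext => w; rewrite mxE.
    exact: cm.
  move=> z; exact: (cvgB (continuous_comp (cc z) (@gammac _)) (cm k z)).
have near1 : \forall z \near y, 0 < gamma (col' k (z *m Q)) - (z *m Q) ord0 k.
  have : nbhs y ((fun z : 'rV[R]_d => gamma (col' k (z *m Q)) - (z *m Q) ord0 k) @^-1`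
      [set t | 0 < t]).
    by apply: Dc; apply: open_nbhs_nbhs; split => //; exact: open_gt.
  by [].
have near2 : \forall z \near y, ball x r z.
  by apply: open_nbhs_nbhs; split => //; exact: ball_open.
have [z [Oz [z1 z2]]] := clO _ sU _ (filterI near1 near2).
have : (Omega `&` ball x r) z by [].
rewrite OE => -[/= zlt _].
by move: z1; rewrite subr_gt0 ltNge (ltW zlt).
Unshelve. all: by end_near. Qed.

End mesh_geometry.

Section nodal_functions.
Context {R : realType} {d : nat} (Omega : set 'rV[R]_d) (T : mesh R d).
Hypothesis hOmega : bounded_lipschitz_domain Omega.
Hypothesis hT : triangulation T Omega.
Variable phi : 'I_(n_nodes T) -> 'rV[R]_d -> R.
Hypothesis hphi : nodal_basis Omega phi.
Local Notation mu := (@lebesgue_rV R d).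
Implicit Types (a b : 'I_(n_cells T)) (i j : 'I_(n_nodes T)) (p : 'I_d) (x : 'rV[R]_d).

Let card_cell a : #|cell_nodes a| = d.+1.
Proof. by case: hT => _ /(_ a)[]. Qed.

Let ind_cell a : affinely_independent (@node _ _ T) (cell_nodes a).
Proof. by case: hT => _ /(_ a)[]. Qed.

Let closure_cells : closure Omega = \bigcup_a @cell _ _ T a.
Proof. by case: hT. Qed.

Let open_Omega : open Omega.
Proof. by case: hOmega. Qed.

Let measurable_Omega : measurable Omega.
Proof. exact: open_measurable_rV. Qed.

Let bounded_Omega : bounded_set Omega.
Proof. by case: hOmega. Qed.

Lemma node_cell a k : k \in cell_nodes a -> cell a (@node _ _ T k).
Proof.
move=> ka; rewrite /cell hullE// => l la.
by rewrite bary_vertex.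
Qed.

(** Both sides are affine on the cell and agree at its vertices. When [j] is not a vertex of the
    cell, both vanish there, thanks to the extension of [bary] by 0. *)
Lemma nodal_basis_cell a j x : cell a x -> phi j x = cell_bary a j x.
Proof.
move=> ax; have [[_ /(_ a)[g [c phiE]]] phi_node] := hphi j.
rewrite phiE// -[in LHS](bary_comb (card_cell a) (@ind_cell a) x).
have E : \sum_(k in cell_nodes a) cell_bary a k x * phi j (node k) = cell_bary a j x.
  under eq_bigr do rewrite phi_node.
  have [ja|ja] := boolP (j \in cell_nodes a).
    rewrite (bigD1 j)//= eqxx mulr1 big1 ?addr0// => k /andP[_ /negbTE ->].
    by rewrite mulr0.
  rewrite big1 ?[RHS]bary_notin// => k ka; case: eqP => [kj|_]; last by rewrite mulr0.
  by move: ja; rewrite -kj ka.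
rewrite -[RHS]E.
under [RHS]eq_bigr => k ka do rewrite (phiE _ (node_cell ka)) mulrDr mulr_sumr.
rewrite big_split/= -mulr_suml [in RHS]/cell_bary (bary_sum (card_cell a) (@ind_cell a)) mul1r.
congr (_ + _); rewrite exchange_big/=; apply: eq_bigr => p _.
rewrite summxE mulr_sumr; apply: eq_bigr => k _.
by rewrite mxE mulrCA.
Qed.

(** A crude common bound for all cellwise slopes; only its independence of the point and of the step
    matters. *)
Definition grad_bound : R := 
  \sum_(a < n_cells T) \sum_(j < n_nodes T) \sum_(p < d) `|cell_grad a j p|.

Lemma grad_bound_ge0 : 0 <= grad_bound.
Proof. by do 3 (apply: sumr_ge0 => ? _). Qed.

Lemma cell_grad_le a j p : `|cell_grad a j p| <= grad_bound.
Proof.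
rewrite /grad_bound (bigD1 a)//= (bigD1 j)//= (bigD1 p)//= -!addrA lerDl.
rewrite !addr_ge0//; repeat (apply: sumr_ge0 => ? _) => //.
Qed.

(** The cells cut the segment into finitely many closed sets, on each of which [phi j] is affine
    with slope at most [grad_bound]. *)
Let line_lipschitz_ge0 j p (t : R) x : 0 <= t ->
  (forall s, 0 <= s <= t -> closure Omega (x + s *: unit_rV R p)) ->
  `|phi j (x + t *: unit_rV R p) - phi j x| <= grad_bound * t.
Proof.
move=> t0 xO.
have := @lipschitz_finite_closed_cover R _ (fun s => phi j (x + s *: unit_rV R p))
  (fun a => [set s | cell a (x + s *: unit_rV R p)]) grad_bound t grad_bound_ge0 t0.
rewrite scale0r addr0; apply.
- move=> a.
  have c1 : continuous (fun s : R => x + s *: unit_rV R p).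
    by move=> s; apply: cvgD; [exact: cvg_cst|apply: cvgZr_tmp; exact: cvg_id].
  apply: (@preimage_closed _ _ (fun s : R => x + s *: unit_rV R p) (cell a)).
    by move=> s _; exact: c1.
  exact: closed_hull.
- by move=> s /xO; rewrite closure_cells => -[a _]; exists a.
- move=> a s s' /= sa s'a; rewrite !(@nodal_basis_cell a)// /cell_bary !bary_shift.
  have -> : bary (@node _ _ T) (cell_nodes a) j x + s * cell_grad a j p -
     (bary (@node _ _ T) (cell_nodes a) j x + s' * cell_grad a j p) =
     cell_grad a j p * (s - s') by ring.
  by rewrite normrM ler_wpM2r// cell_grad_le.
Qed.

Lemma line_lipschitz j p (t : R) x :
  (forall s, `|s| <= `|t| -> closure Omega (x + s *: unit_rV R p)) ->
  `|phi j (x + t *: unit_rV R p) - phi j x| <= grad_bound * `|t|.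
Proof.
move=> xO; have [t0|t0] := leP 0 t.
  rewrite (ger0_norm t0); apply: line_lipschitz_ge0 => // s /andP[s0 st].
  by apply: xO; rewrite !ger0_norm.
have nt0 : 0 <= - t by rewrite oppr_ge0 ltW.
have := @line_lipschitz_ge0 j p (- t) (x + t *: unit_rV R p) nt0.
rewrite -addrA -scalerDl subrr scale0r addr0 distrC (ltr0_norm t0); apply.
move=> s /andP[s0 st]; rewrite -addrA -scalerDl; apply: xO.
rewrite (ltr0_norm t0) ler_norml opprK; apply/andP; split; lra.
Qed.

Lemma nodal_ge0 j x : closure Omega x -> 0 <= phi j x <= 1.
Proof.
rewrite closure_cells => -[a _ ax]; rewrite (@nodal_basis_cell a)//.
have [ja|ja] := boolP (j \in cell_nodes a); last first.
  by rewrite [cell_bary _ _ _]bary_notin// lexx ler01.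
apply/andP; split; last exact: bary_le1.
by move: ax; rewrite /cell hullE//; apply.
Qed.

(** Measurability comes from an explicit formula on [Omega]: the maximum over the cells of indicator
    times barycentric coordinate. A sum would count points on common faces several times; the
    default 0 of the maximum is harmless because [phi j] is nonnegative there. *)
Lemma bmfun_nodal j : bmfun (phi j \_ Omega).
Proof.
pose m x : R := \big[Num.max/0]_a (\1_(@cell _ _ T a) x * cell_bary a j x).
have E : phi j \_ Omega = fun x => \1_Omega x * m x.
  apply/funext => x; rewrite patchE indicE; case: ifPn => xO; last by rewrite mul0r.
  rewrite mul1r; have cx : closure Omega x by apply: subset_closure; exact/set_mem.
  have := cx; rewrite closure_cells => -[a _ ax].
  have /andP[p0 _] := nodal_ge0 j cx.
  have term b : \1_(@cell _ _ T b) x * cell_bary b j x <= phi j x.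
    rewrite indicE; have [bx|bx] := pselect (cell b x).
      by rewrite mem_set// mul1r -nodal_basis_cell.
    by rewrite memNset// mul0r.
  apply/eqP; rewrite eq_le /m; apply/andP; split; last by apply/bigmax_leP; split.
  apply: le_trans (le_bigmax _ _ a).
  by rewrite indicE mem_set// mul1r -nodal_basis_cell.
have mm : measurable_fun setT m.
  rewrite /m; elim: (index_enum _) => [|a s IH].
    by under eq_fun do rewrite big_nil; exact: measurable_cst.
  under eq_fun do rewrite big_cons; apply: measurable_maxr => //.
  apply: measurable_funM; first by apply: measurable_indic; exact: measurable_hull.
  by apply: continuous_measurable_rV; exact: continuous_bary.
rewrite E; apply: bmfunMr => //; first exact: bmfun_indic.
exists 1 => x; rewrite indicE; have [xO|xO] := boolP (x \in Omega); last by rewrite eqxx.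
move=> _; have := congr1 (fun f => f x) E; rewrite patchE xO indicE xO mul1r => <-.
have /andP[p0 p1] := nodal_ge0 j (subset_closure (set_mem xO)).
by rewrite ger0_norm.
Qed.

(** Open cells are disjoint, so at most one term survives; on the faces, which form a null set, the
    value is 0. *)
Definition pw_partial j p x : R :=
  \sum_(a < n_cells T) cell_grad a j p * \1_(cell_interior a) x.

Lemma pw_partialE a j p x : cell_interior a x -> pw_partial j p x = cell_grad a j p.
Proof.
move=> ax; rewrite /pw_partial (bigD1 a)//= indicE mem_set// mulr1.
rewrite big1 ?addr0// => b ba; rewrite indicE memNset ?mulr0// => bx.
move/eqP: ba; apply; apply/esym.
exact: (cell_interior_disjoint hT ax (cell_interior_sub hT bx)).
Qed.

Lemma bounded_cell_interior a : bounded_set (@cell_interior _ _ T a).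
Proof.
have [M [Mr OM]] := bounded_Omega; exists M; split => // N MN x xa.
exact: (OM _ MN _ (cell_interior_domain hOmega hT xa)).
Qed.

Lemma bmfun_pw_partial j p : bmfun (pw_partial j p).
Proof.
apply: bmfun_sum => a; apply: bmfunZ; apply: bmfun_indic.
  exact: measurable_open_simplex.
exact: bounded_cell_interior.
Qed.

Lemma diff_quot_nodal_cvg a j p x : cell_interior a x ->
  diff_quot (unit_rV R p) t (phi j \_ Omega) x @[t --> 0^'] --> cell_grad a j p.
Proof.
move=> ax.
have ct : x + t *: unit_rV R p @[t --> (0 : R)] --> x.
  rewrite -[X in _ --> X]addr0 -(scale0r (unit_rV R p)); apply: cvgD; first exact: cvg_cst.
  by apply: cvgZr_tmp; exact: cvg_id.
have : nbhs x (cell_interior a).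
  by apply: open_nbhs_nbhs; split => //; exact: open_open_simplex.
move=> /ct H0.
have H : \forall t \near (0 : R)^', cell_interior a (x + t *: unit_rV R p).
  exact: nbhs_dnbhs H0.
apply: cvg_near_cst.
have phiE y : cell_interior a y -> (phi j \_ Omega) y = cell_bary a j y.
  move=> ay; rewrite patchE mem_set; last exact: (cell_interior_domain hOmega hT ay).
  exact: nodal_basis_cell (cell_interior_sub hT ay).
near=> t; rewrite /diff_quot !phiE//; last by near: t; exact: H.
have t0 : t != 0 by near: t; exact: nbhs_dnbhs_neq.
by rewrite /cell_bary bary_shift addrAC subrr add0r mulKf.
Unshelve. all: by end_near. Qed.

(** The margin [r] keeps the whole segment of increments in [Omega]; across the boundary the
    extension by zero may jump and the quotient would not be bounded uniformly in [t]. *)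
Lemma diff_quot_nodal_bound j p x (t r : R) : ball x r `<=` Omega -> `|t| < r -> t != 0 ->
  `|diff_quot (unit_rV R p) t (phi j \_ Omega) x| <= grad_bound.
Proof.
move=> xr tr t0.
have r0 : 0 < r by apply: le_lt_trans tr.
have sO s : `|s| <= `|t| -> Omega (x + s *: unit_rV R p).
  move=> st; apply: xr; split => // i k; rewrite (ord1 i) /ball/= !mxE.
  rewrite opprD addNKr normrN normrM.
  apply: le_lt_trans tr; apply: le_trans st.
  by rewrite ler_piMr//; case: (_ && _); rewrite ?normr1 ?normr0.
have xO : Omega x by have := sO 0; rewrite normr0 scale0r addr0; apply.
rewrite /diff_quot !patchE !mem_set//; last exact: sO.
rewrite normrM normfV ler_pdivrMl ?normr_gt0// mulrC.
by apply: line_lipschitz => s /sO; exact: subset_closure.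
Qed.

End nodal_functions.

(** * Weak derivatives of the nodal functions *)

Section smooth_increments.
Context {R : realType} {n : nat}.
Implicit Types (psi : 'rV[R]_n -> R) (x e : 'rV[R]_n).

(** Starting the denominators at 2 makes every step strictly smaller than [c] in absolute value, so
    that steps scaled by a margin stay below it. *)
Lemma cvg_shrinking_steps (c : R) : c != 0 -> c * k.+2%:R^-1 @[k --> \oo] --> (0 : R)^'.
Proof.
move=> c0.
have c1 : c * k.+2%:R^-1 @[k --> \oo] --> (0 : R).
  rewrite -(mulr0 c); apply: cvgMl_tmp.
  by have := @cvg_harmonic R; rewrite -(cvg_shiftS (@harmonic R)).
move=> P /= P0.
have H : \forall k \near \oo, c * k.+2%:R^-1 != 0 -> P (c * k.+2%:R^-1) := c1 _ P0.
by apply: filterS H => k; apply; rewrite mulf_neq0// invr_eq0 pnatr_eq0.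
Qed.

Lemma is_derive_line psi e x (s : R) : (forall y, derivable psi y e) ->
  is_derive s 1 (fun s => psi (x + s *: e)) ('D_e psi (x + s *: e)).
Proof.
move=> dpsi; apply: is_derive_cvg.
rewrite (_ : (fun h : R => _) =
  (fun h => h^-1 *: ((psi \o shift (x + s *: e)) (h *: e) - psi (x + s *: e)))); last first.
  apply/funext => h /=; rewrite [h *: 1]mulr1; congr (_ *: (psi _ - _)).
  by rewrite scalerDl addrCA.
exact: dpsi.
Qed.

Lemma diff_quot_derive_bound psi e (M : R) x t : (forall y, derivable psi y e) ->
  (forall y, `|'D_e psi y| <= M) -> `|diff_quot e t psi x| <= M.
Proof.
move=> dpsi psiM; have M0 : 0 <= M by apply: le_trans (psiM 0).
have [->|t0] := eqVneq t 0; first by rewrite /diff_quot invr0 mul0r normr0.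
pose F (s : R) : R := psi (x + s *: e); pose F' (s : R) : R := 'D_e psi (x + s *: e).
have dF (s : R) : is_derive s 1 F (F' s) by exact: is_derive_line.
have cF : continuous F.
  by move=> s; apply/differentiable_continuous/derivable1_diffP.
have key (a b : R) : a < b -> `|F b - F a| <= M * (b - a).
  move=> ab; have [c _ ->] := MVT ab (fun s _ => dF s) (continuous_subspaceT cF).
  by rewrite normrM [X in _ * X]gtr0_norm ?subr_gt0// ler_wpM2r ?psiM// subr_ge0 ltW.
have Fx : psi x = F 0 by rewrite /F scale0r addr0.
rewrite /diff_quot -/(F t) Fx normrM normfV ler_pdivrMl ?normr_gt0// mulrC.
have [tn|tp|] := ltgtP t 0; last by move/eqP; rewrite (negbTE t0).
  by rewrite distrC (le_trans (key _ _ tn))// (ltr0_norm tn) sub0r.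
by rewrite (le_trans (key _ _ tp))// (gtr0_norm tp) subr0.
Qed.

Lemma diff_quot_derive_cvg psi e x : derivable psi x e ->
  diff_quot e t psi x @[t --> 0^'] --> 'D_e psi x.
Proof.
move=> dpsi; rewrite (_ : (fun t => _) =
  (fun h => h^-1 *: ((psi \o shift x) (h *: e) - psi x))); first exact: dpsi.
by apply/funext => h /=; rewrite /diff_quot (addrC x).
Qed.

End smooth_increments.

Section nodal_weak_derivative.
Context {R : realType} {d : nat} (Omega : set 'rV[R]_d) (T : mesh R d).
Hypothesis hOmega : bounded_lipschitz_domain Omega.
Hypothesis hT : triangulation T Omega.
Variable phi : 'I_(n_nodes T) -> 'rV[R]_d -> R.
Hypothesis hphi : nodal_basis Omega phi.
Local Notation mu := (@lebesgue_rV R d).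
Local Notation e p := (unit_rV R p).

Let open_Omega : open Omega.
Proof. by case: hOmega. Qed.

Let measurable_Omega : measurable Omega.
Proof. exact: open_measurable_rV. Qed.

Let bounded_Omega : bounded_set Omega.
Proof. by case: hOmega. Qed.

Let ae_Omega : {ae mu, forall x, Omega x -> exists a, @cell_interior _ _ T a x}.
Proof.
apply: filterS (ae_cell_interior hT) => x H Ox.
by apply: H; exact: subset_closure.
Qed.

Lemma test_function_partial psi p : test_function Omega psi -> bmfun (partial p psi).
Proof.
move=> [spsi [K [cK _ K0]]].
apply: (compact_supp_bmfun (K := K)) => //; first exact: (spsi [:: p]).1.
move=> x Kx; rewrite /partial -(derive_cst (0 : R) x (e p)).
apply: near_eq_derive.
have oK : open (~` K) by rewrite openC; exact: compact_closed.
by apply: filterS (open_nbhs_nbhs (conj oK Kx)) => y Ky; rewrite K0.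
Qed.

(** Passage to the limit in the discrete integration by parts. All steps are shorter than the
    distance margin [tau] of the support of [psi], so the quotients of [u] are bounded wherever
    [psi] is nonzero; they converge on the open cells, hence almost everywhere in [Omega]. *)
Lemma is_weak_partial_nodal j p : is_weak_partial Omega p (phi j) (@pw_partial _ _ T j p).
Proof.
pose u := phi j \_ Omega; pose h := @pw_partial _ _ T j p.
have bu : bmfun u := bmfun_nodal hOmega hT hphi j.
have bh : bmfun h := bmfun_pw_partial hOmega hT j p.
have restr (f : 'rV[R]_d -> R) : f \_ Omega = fun x => \1_Omega x * f x.
  by apply/funext => x; rewrite patchE indicE; case: ifPn => _; rewrite ?mul1r ?mul0r.
split.
  by rewrite /L2 restr; apply: bmfun_L2; apply: bmfunM => //; exact: bmfun_indic.
move=> psi tpsi; have [spsi [K [cK KO K0]]] := tpsi.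
have [tau tau0 tauO] := compact_ball_margin cK open_Omega KO.
have bpsi := test_function_bmfun tpsi.
have bdpsi := test_function_partial p tpsi.
have dpsi y : derivable psi y (e p) := (spsi [::]).2 p y.
pose t k : R := tau * k.+2%:R^-1.
have t0 k : t k != 0 by rewrite mulf_neq0 ?gt_eqF// invr_gt0.
have tt k : `|t k| < tau.
  rewrite normrM (gtr0_norm tau0) gtr0_norm ?invr_gt0//.
  by rewrite gtr_pMr// invf_lt1// ltr1n.
have tc : t k @[k --> \oo] --> (0 : R)^' by apply: cvg_shrinking_steps; rewrite gt_eqF.
have ntc : - t k @[k --> \oo] --> (0 : R)^'.
  rewrite /t; under eq_cvg do rewrite -mulNr.
  by apply: cvg_shrinking_steps; rewrite oppr_eq0 gt_eqF.
have [U U0 uU] := bmfun_bounded bu; have [U' U'0 u0] := bmfun_supp bu.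
have [M M0 psiM] := bmfun_bounded bdpsi.
have [N N0 psiN] := bmfun_bounded bpsi; have [N' N'0 psi0] := bmfun_supp bpsi.
have limA : \int[mu]_x (diff_quot (e p) (t k) psi x * u x) @[k --> \oo] -->
    \int[mu]_x (partial p psi x * u x).
  apply: (@bounded_cvg_Rintegral _ _ _ _ (Num.max (M * U) U')).
  - by move=> k; have [] := bmfunM (bmfun_diff_quot (e p) (t k) bpsi) bu.
  - by have [] := bmfunM bdpsi bu.
  - move=> k x; rewrite le_max normrM ler_pM//.
    by apply: diff_quot_derive_bound.
  - move=> k x xc; rewrite u0 ?mulr0// => xc'; apply: xc.
    by apply: cubeS xc'; rewrite le_max lexx orbT.
  - apply: aeW => x; apply: cvgMr_tmp.
    exact: (cvg_comp _ _ tc (diff_quot_derive_cvg (dpsi x))).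
have limB : \int[mu]_x (psi x * diff_quot (e p) (- t k) u x) @[k --> \oo] -->
    \int[mu]_x (psi x * h x).
  apply: (@bounded_cvg_Rintegral _ _ _ _ (Num.max (N * grad_bound T) N')).
  - by move=> k; have [] := bmfunM bpsi (bmfun_diff_quot (e p) (- t k) bu).
  - by have [] := bmfunM bpsi bh.
  - move=> k x; rewrite le_max normrM.
    have [Kx|Kx] := pselect (K x); last first.
      by rewrite K0// normr0 mul0r mulr_ge0// grad_bound_ge0.
    rewrite ler_pM//.
    apply: (@diff_quot_nodal_bound _ _ _ _ hT _ hphi _ _ _ _ tau); rewrite ?normrN ?oppr_eq0//.
    exact: tauO.
  - move=> k x xc; rewrite psi0 ?mul0r// => xc'; apply: xc.
    by apply: cubeS xc'; rewrite le_max lexx orbT.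
  - apply: filterS ae_Omega => x H; have [Ox|nOx] := pselect (Omega x).
      have [a xa] := H Ox; apply: cvgMl_tmp; rewrite /h (pw_partialE hT _ _ xa).
      exact: (cvg_comp _ _ ntc (diff_quot_nodal_cvg hOmega hT hphi xa)).
    rewrite K0; last by move=> /KO.
    by under eq_cvg do rewrite mul0r; rewrite mul0r; exact: cvg_cst.
have E : \int[mu]_x (partial p psi x * u x) = - \int[mu]_x (psi x * h x).
  apply: (cvg_unique _ limA) => //.
  rewrite (_ : (fun k => _) = fun k => - \int[mu]_x (psi x * diff_quot (e p) (- t k) u x)).
    exact: cvgN.
  by apply/funext => k; exact: diff_quot_by_parts.
have e1 (f g : 'rV[R]_d -> R) : \int[mu]_(x in Omega) (f x * g x) =
    \int[mu]_x (f \_ Omega x * g x).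
  rewrite Rintegral_mkcond; apply: eq_Rintegral => x _; rewrite !patchE.
  by case: ifPn => // _; rewrite mul0r.
rewrite !e1 -/u -/h; transitivity (\int[mu]_x (partial p psi x * u x)).
  by apply: eq_Rintegral => x _; rewrite mulrC.
rewrite E; congr (- _); apply: eq_Rintegral => x _; rewrite mulrC patchE.
case: ifPn => // /negP xO; rewrite K0 ?mulr0// => /KO xO'.
by apply: xO; exact/mem_set.
Qed.

End nodal_weak_derivative.

(** * Symmetry of the integrals of products of derivatives *)

Lemma near_diff_quot_eq {R : realType} {n : nat} (f g : 'rV[R]_n -> R) (v x : 'rV[R]_n) :
  (\forall y \near x, f y = g y) ->
  \forall t \near (0 : R)^', diff_quot v t f x = diff_quot v t g x.
Proof.
move=> fg; have fgx : f x = g x := nbhs_singleton fg.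
have ct : x + t *: v @[t --> (0 : R)] --> x.
  rewrite -[X in _ --> X]addr0 -(scale0r v); apply: cvgD; first exact: cvg_cst.
  by apply: cvgZr_tmp; exact: cvg_id.
have H : \forall t \near (0 : R)^', f (x + t *: v) = g (x + t *: v).
  exact: nbhs_dnbhs (ct _ fg).
by apply: filterS H => t E; rewrite /diff_quot E fgx.
Qed.

Section symmetry.
Context {R : realType} {d : nat} (Omega : set 'rV[R]_d) (T : mesh R d).
Hypothesis hOmega : bounded_lipschitz_domain Omega.
Hypothesis hT : triangulation T Omega.
Variable phi : 'I_(n_nodes T) -> 'rV[R]_d -> R.
Hypothesis hphi : nodal_basis Omega phi.
Local Notation mu := (@lebesgue_rV R d).
Local Notation e p := (unit_rV R p).
Local Notation L := (grad_bound T).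
Implicit Types (a b : 'I_(n_cells T)) (i j : 'I_(n_nodes T)) (p q : 'I_d) (x : 'rV[R]_d).

Let card_cell a : #|cell_nodes a| = d.+1.
Proof. by case: hT => _ /(_ a)[]. Qed.

Let ind_cell a : affinely_independent (@node _ _ T) (cell_nodes a).
Proof. by case: hT => _ /(_ a)[]. Qed.

Let closure_cells : closure Omega = \bigcup_a @cell _ _ T a.
Proof. by case: hT. Qed.

(* The integral over [Omega] of [d_p phi_i * d_q phi_j], cell by cell. *)
Definition gradient_mass i j p q : R :=
  \sum_(a < n_cells T) fine (mu (cell_interior a)) * (cell_grad a i p * cell_grad a j q).

Lemma gradient_massC i j p q : gradient_mass i j p q = gradient_mass j i q p.
Proof. by apply: eq_bigr => a _; rewrite [cell_grad _ _ _ * _]mulrC. Qed.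

Section truncation.
Variables (i : 'I_(n_nodes T)) (r lam : R).
(** [lamr] confines the cap to the ball of radius r about the node. Its quotients with steps shorter
    than r then live in the ball of radius 2r, and the factor 4 leaves a margin of 2r around each
    point of that ball. *)
Hypotheses (r0 : 0 < r) (lam0 : 0 < lam) (lam1 : lam < 1).
Hypothesis ballO : ball (@node _ _ T i) (4 * r) `<=` Omega.
Hypothesis lamr : lam * (1 + \sum_(k < n_nodes T) `|@node _ _ T k - @node _ _ T i|) <= r.

Local Notation P := (@node _ _ T i).

Let u := phi i \_ Omega.
(* The cap of the hat function [phi i] above the level [1 - lam]; unlike
   [phi i] it is compactly supported in [Omega]. *)
Let f x := Num.max (u x - (1 - lam)) 0.

Let cap a : set 'rV[R]_d := corner (@node _ _ T) (cell_nodes a) i lam.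

(** Where the coordinate of [i] exceeds 1 - lam, every other coordinate is at most lam. Since P - x
    is the combination of the P - P_m with these coordinates, its entries are at most lam times the
    sum in [lamr]; the summand 1 there makes the bound by r strict. *)
Let f_near x : f x != 0 -> ball P r x.
Proof.
rewrite /f maxEle; case: ifPn => [_|]; first by rewrite eqxx.
rewrite -ltNge subr_gt0 => ux _.
have xO : x \in Omega.
  by move: ux; rewrite /u patchE; case: ifPn => // _; rewrite ltNge subr_ge0 (ltW lam1).
move: ux; rewrite /u patchE xO => phix.
have := subset_closure (set_mem xO); rewrite closure_cells => -[a _ ax].
move: phix; rewrite (nodal_basis_cell hT hphi _ ax) => bx.
have ia : i \in cell_nodes a.
  apply: contraLR bx => /bary_notin; rewrite /cell_bary => ->.
  by rewrite -leNgt subr_ge0 ltW.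
split => // k l; rewrite (ord1 k) /ball/=.
have b0 m : m \in cell_nodes a -> 0 <= cell_bary a m x.
  by move: ax; rewrite /cell hullE//; apply.
have sb := bary_sum (card_cell a) (@ind_cell a) x.
have E : P - x = \sum_(m in cell_nodes a) cell_bary a m x *: (P - @node _ _ T m).
  under eq_bigr do rewrite scalerBr.
  by rewrite sumrB -scaler_suml sb scale1r (bary_comb (card_cell a) (@ind_cell a) x).
have -> : P ord0 l - x ord0 l = (P - x) ord0 l by rewrite !mxE.
rewrite E (bigD1 i)//= subrr scaler0 add0r summxE.
have bl m : m \in cell_nodes a -> m != i -> cell_bary a m x <= lam.
  move=> ma mi; have := sb; rewrite (bigD1 i)//= (bigD1 m)/=; last by rewrite ma mi.
  have : 0 <= \sum_(k | (k \in cell_nodes a) && (k != i) && (k != m)) cell_bary a k x.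
    by apply: sumr_ge0 => ? /andP[/andP[? _] _]; exact: b0.
  move: bx; rewrite /cell_bary; lra.
apply: (@le_lt_trans _ _ (lam * \sum_(k < n_nodes T) `|@node _ _ T k - P|)); last first.
  by move: lamr; rewrite mulrDr mulr1; have := lam0; lra.
rewrite (le_trans (ler_norm_sum _ _ _))// mulr_sumr.
rewrite [leRHS](bigID (fun k => (k \in cell_nodes a) && (k != i)))/=.
rewrite -[leLHS]addr0 lerD//; last first.
  by apply: sumr_ge0 => m _; rewrite mulr_ge0// ltW.
apply: ler_sum => m /andP[ma mi]; rewrite mxE normrM ler_pM//.
  by rewrite ger0_norm ?b0// bl.
by rewrite distrC coord_le_norm.
Qed.

Let bmfun_f : bmfun f.
Proof.
have bu : bmfun u := bmfun_nodal hOmega hT hphi i.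
have [M M0 uM] := bmfun_bounded bu; have [M' _ u0] := bmfun_supp bu.
apply: (@bmfun_intro _ _ _ M M').
- apply: measurable_maxr => //; apply: measurable_funB => //.
  by case: bu.
- move=> x; rewrite /f maxEle; case: ifPn => [_|]; first by rewrite normr0.
  rewrite -ltNge => h; rewrite gtr0_norm//; have := uM x; have := ler_norm (u x).
  have := lam1; lra.
- by move=> x xM'; rewrite /f (u0 _ xM') sub0r max_r// oppr_le0 subr_ge0 ltW.
Qed.

Let near_domain x (s : R) : ball P (2 * r) x -> 0 < s -> s <= 2 * r -> ball x s `<=` Omega.
Proof.
move=> Px s0 sr y xy; apply: ballO; rewrite (_ : 4 * r = 2 * r + 2 * r); last by ring.
by apply: ball_triangle Px _; exact: le_ball xy.
Qed.

Let shift_ball x p (t s : R) : ball P s x -> ball P (s + `|t|) (x + t *: e p).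
Proof.
move=> [s0 xs]; split; first by rewrite ltr_pwDl.
move=> k l; have := xs k l; rewrite (ord1 k) /ball/= !mxE => h.
rewrite opprD addrA (le_lt_trans (ler_normB _ _))// ltr_leD// normrM.
by rewrite ler_piMr//; case: (_ && _); rewrite ?normr1 ?normr0.
Qed.

Let diff_quot_f_supp x p (t : R) : `|t| < r -> diff_quot (e p) t f x != 0 -> ball P (2 * r) x.
Proof.
move=> tr; have [fx0|/f_near Px _] := eqVneq (f x) 0; last first.
  by apply: le_ball Px; rewrite ler_peMl// ?ltW// ltr1n.
rewrite /diff_quot fx0 subr0 mulf_eq0 negb_or => /andP[_ /f_near/(@shift_ball _ p (- t))].
rewrite -addrA -scalerDl subrr scale0r addr0 normrN; apply: le_ball.
by rewrite mulr_natl mulr2n lerD2l ltW.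
Qed.

(** Truncation from below is 1-Lipschitz, so the increments of [f] are no larger than those of
    [u]. *)
Let diff_quot_f_bound x p (t : R) : `|t| < r -> t != 0 -> `|diff_quot (e p) t f x| <= L.
Proof.
move=> tr t0; have [->|/(diff_quot_f_supp tr) Px] := eqVneq (diff_quot (e p) t f x) 0.
  by rewrite normr0 grad_bound_ge0.
have xO : ball x r `<=` Omega by apply: near_domain; rewrite // ler_peMl ?ltW// ltr1n.
apply: le_trans (diff_quot_nodal_bound hT hphi i p xO tr t0).
rewrite /diff_quot !normrM ler_wpM2l// /f -/u.
set A := u (x + _); set B := u x.
have := ler_norm (A - B); have := ler_norm (B - A); rewrite [`|B - A|]distrC ler_norml.
by have [h1|h1] := leP (A - (1 - lam)) 0; have [h2|h2] := leP (B - (1 - lam)) 0;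
  move=> h3 h4; apply/andP; split; lra.
Qed.

(** The cap has a kink along the level 1 - lam of [phi i], so this level set must be null inside
    each cell. *)
Let ae_off_slices : {ae mu, forall x, forall a, cell_interior a x -> cell_bary a i x != 1 - lam}.
Proof.
suff H a : {ae mu, forall x, cell_interior a x -> cell_bary a i x != 1 - lam}.
  exact: (@filter_forall _ _ (fun a x => cell_interior a x -> cell_bary a i x != 1 - lam) _ _ H).
have [ia|ia] := boolP (i \in cell_nodes a); last first.
  apply: aeW => x _; rewrite [cell_bary _ _ _]bary_notin//.
  by rewrite eq_sym subr_eq0 gt_eqF.
exists (cell_interior a `&` [set x | cell_bary a i x = 1 - lam]); split.
- by apply: measurableI; [exact: measurable_open_simplex|exact: measurable_bary_eq].
- by apply: negligible_slice => //; exact: ltW.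
- move=> x /= /not_implyP[xa] /negP; rewrite negbK => /eqP; by split.
Qed.

(** Off faces and kinks, [f] is near [x] either identically 0 or affine with the gradient of
    [phi i], so its quotient is eventually constant. In the flat case the product is eventually 0
    whatever the second quotient does, which covers the points outside the closure of [Omega]. *)
Let prod_cvg j p q (t : nat -> R) : t k @[k --> \oo] --> (0 : R)^' ->
  - t k @[k --> \oo] --> (0 : R)^' ->
  {ae mu, forall x,
    diff_quot (e p) (t k) f x * diff_quot (e q) (- t k) (phi j \_ Omega) x @[k --> \oo] -->
    \sum_(a < n_cells T) (cell_grad a i p * cell_grad a j q) * \1_(cap a) x}.
Proof.
move=> tc ntc; apply: filterS2 ae_off_slices (ae_cell_interior hT) => x xs xO.
have capU a : cap a `<=` cell_interior a by move=> y [].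
have flat : (\forall y \near x, f y = 0) -> (forall a, ~ cap a x) ->
    diff_quot (e p) (t k) f x * diff_quot (e q) (- t k) (phi j \_ Omega) x @[k --> \oo] -->
    \sum_(a < n_cells T) (cell_grad a i p * cell_grad a j q) * \1_(cap a) x.
  move=> fx capx; rewrite big1; last by move=> a _; rewrite indicE memNset ?mulr0.
  apply: cvg_near_cst.
  have H : \forall s \near (0 : R)^', diff_quot (e p) s f x = diff_quot (e p) s (cst 0) x.
    exact: near_diff_quot_eq fx.
  have H' : \forall k \near \oo,
      diff_quot (e p) (t k) f x = diff_quot (e p) (t k) (cst 0) x := tc _ H.
  by apply: filterS H' => k /= ->; rewrite /diff_quot subrr mulr0 mul0r.
have [clx|nclx] := pselect (closure Omega x); last first.
  apply: flat; last by move=> a /capU/(cell_interior_sub hT)/(cell_sub_closure hT).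
  have : open (~` closure Omega) by rewrite openC; exact: closed_closure.
  move=> oC; apply: filterS (open_nbhs_nbhs (conj oC nclx)) => y ny.
  rewrite /f /u patchE memNset; last by move=> /subset_closure.
  by rewrite sub0r max_r// oppr_le0 subr_ge0 ltW.
have [a xa] := xO clx.
have nU : nbhs x (cell_interior a).
  by apply: open_nbhs_nbhs; split => //; exact: open_open_simplex.
have fE y : cell_interior a y -> f y = Num.max (cell_bary a i y - (1 - lam)) 0.
  move=> ya; rewrite /f /u patchE mem_set; last exact: (cell_interior_domain hOmega hT ya).
  by rewrite (nodal_basis_cell hT hphi _ (cell_interior_sub hT ya)).
have cb : continuous (cell_bary a i) by exact: continuous_bary.
have capx b : cap b x -> b = a.
  by move=> /capU xb; apply/esym; exact: (cell_interior_disjoint hT xa (cell_interior_sub hT xb)).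
have [blt|bgt|/eqP] := ltgtP (cell_bary a i x) (1 - lam); last by rewrite (negbTE (xs a xa)).
- apply: flat; last first.
    by move=> b xb; move: (xb); rewrite (capx _ xb) => -[_ /=]; rewrite ltNge (ltW blt).
  have nb : \forall y \near x, cell_bary a i y < 1 - lam.
    by have /cvgr_lt := cb x; apply.
  apply: filterS2 nU nb => y ya yb; by rewrite fE//; apply/max_idPr; rewrite subr_le0 ltW.
- have capa : cap a x by split.
  rewrite (bigD1 a)//= indicE mem_set//.
  rewrite mulr1 big1 ?addr0; last first.
    move=> b ba; rewrite indicE memNset ?mulr0// => /capx ab.
    by rewrite ab eqxx in ba.
  apply: cvgM; last exact: (cvg_comp _ _ ntc (diff_quot_nodal_cvg hOmega hT hphi xa)).
  apply: cvg_near_cst.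
  have nb : \forall y \near x, 1 - lam < cell_bary a i y.
    by have /cvgr_gt := cb x; apply.
  have H : \forall s \near (0 : R)^', diff_quot (e p) s f x =
      diff_quot (e p) s (fun y => cell_bary a i y - (1 - lam)) x.
    apply: near_diff_quot_eq; apply: filterS2 nU nb => y ya yb.
    by rewrite fE//; apply/max_idPl; rewrite subr_ge0 ltW.
  have H' : \forall k \near \oo, diff_quot (e p) (t k) f x =
      diff_quot (e p) (t k) (fun y => cell_bary a i y - (1 - lam)) x := tc _ H.
  have H0 : \forall k \near \oo, t k != 0 := tc _ (nbhs_dnbhs_neq (0 : R)).
  apply: filterS2 H' H0 => k -> tk0.
  rewrite /diff_quot /cell_bary bary_shift -/(cell_grad a i p).
  by field.
Qed.

Let measurable_cap a : measurable (cap a).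
Proof. exact: measurable_corner. Qed.

Let bounded_cap a : bounded_set (cap a).
Proof.
have [M [Mr UM]] := bounded_cell_interior hOmega hT a; exists M; split => // N MN x [xa _].
exact: UM MN _ xa.
Qed.

(** Each corner at node [i] has lam^d times the measure of its cell; cells that do not contain the
    node contribute 0 because [cell_grad] vanishes there. *)
Let cap_mass j p q :
  \int[mu]_x (\sum_(a < n_cells T) (cell_grad a i p * cell_grad a j q) * \1_(cap a) x) =
  lam ^+ d * gradient_mass i j p q.
Proof.
rewrite Rintegral_sum_indic// mulr_sumr; apply: eq_bigr => a _.
have [ia|ia] := boolP (i \in cell_nodes a); last first.
  rewrite (_ : cell_grad a i p = 0) ?mul0r ?mulr0// /cell_grad /bary_grad /bary_coef.
  by rewrite big1// => k /eqP ki; move: ia; rewrite -ki enum_valP.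
rewrite /cap lebesgue_corner// ?ltW// fineM//; first by rewrite /=; ring.
rewrite ge0_fin_numE//; apply: le_lt_trans (lebesgue_hull_fin (card_cell a) (@ind_cell a)).
apply: le_measure; rewrite ?inE; last exact: open_simplex_sub_hull.
  exact: measurable_open_simplex.
exact: measurable_hull.
Qed.

Lemma gradient_mass_sym_trunc j p q : gradient_mass i j p q = gradient_mass i j q p.
Proof.
pose w := phi j \_ Omega; have bw : bmfun w := bmfun_nodal hOmega hT hphi j.
pose t k : R := r * k.+2%:R^-1.
have t0 k : t k != 0 by rewrite mulf_neq0 ?gt_eqF// invr_gt0.
have tr k : `|t k| < r.
  rewrite normrM (gtr0_norm r0) gtr0_norm ?invr_gt0//.
  by rewrite gtr_pMr// invf_lt1// ltr1n.
have tc : t k @[k --> \oo] --> (0 : R)^' by apply: cvg_shrinking_steps; rewrite gt_eqF.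
have ntc : - t k @[k --> \oo] --> (0 : R)^'.
  rewrite /t; under eq_cvg do rewrite -mulNr.
  by apply: cvg_shrinking_steps; rewrite oppr_eq0 gt_eqF.
have [M OM] : exists M, Omega `<=` cube M.
  have [_ _ _ bO _] := hOmega; have [M OM] := bounded_set_cube bO.
  by exists (M + 1); apply: OM; rewrite ltrDl.
have L0 : 0 <= L := grad_bound_ge0 T.
have lim p' q' :
    \int[mu]_x (diff_quot (e p') (t k) f x * diff_quot (e q') (- t k) w x) @[k --> \oo] -->
    lam ^+ d * gradient_mass i j p' q'.
  rewrite -cap_mass; apply: (@bounded_cvg_Rintegral _ _ _ _ (Num.max (L * L) M)).
  - move=> k; have [] // := bmfunM (bmfun_diff_quot (e p') (t k) bmfun_f)
      (bmfun_diff_quot (e q') (- t k) bw).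
  - have [] // := @bmfun_sum R d _ (index_enum 'I_(n_cells T))
      (fun a x => cell_grad a i p' * cell_grad a j q' * \1_(cap a) x).
    by move=> a; apply: bmfunZ; exact: bmfun_indic.
  - move=> k x; rewrite le_max normrM.
    have [->|/(diff_quot_f_supp (tr k)) Px] := eqVneq (diff_quot (e p') (t k) f x) 0.
      by rewrite normr0 mul0r mulr_ge0.
    rewrite ler_pM//; first exact: diff_quot_f_bound.
    apply: (@diff_quot_nodal_bound _ _ _ _ hT _ hphi _ _ _ _ r); rewrite ?normrN ?oppr_eq0//.
    by apply: near_domain; rewrite // ler_peMl ?ltW// ltr1n.
  - move=> k x xc; have [->|/(diff_quot_f_supp (tr k)) Px] := eqVneq (diff_quot (e p') (t k) f x) 0.
      by rewrite mul0r.
    exfalso; apply: xc; apply: (@cubeS _ _ M); first by rewrite le_max lexx orbT.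
    apply: OM; apply: (near_domain Px r0); last exact: ballxx.
    by rewrite ler_peMl ?ltW// ltr1n.
  - exact: prod_cvg.
apply: (mulfI (x := lam ^+ d)); first by rewrite expf_neq0// gt_eqF.
apply: (cvg_unique _ (lim p q)) => //.
rewrite (_ : (fun k => _) =
    fun k => \int[mu]_x (diff_quot (e q) (t k) f x * diff_quot (e p) (- t k) w x)).
  exact: lim.
by apply/funext => k; exact: diff_quot_diff_quot_sym.
Qed.

End truncation.

Lemma gradient_mass_sym i j p q : Omega (@node _ _ T i) ->
  gradient_mass i j p q = gradient_mass i j q p.
Proof.
move=> iO.
have oO : open Omega by case: hOmega.
have /nbhs_ballP[s /= s0 sO] := open_nbhs_nbhs (conj oO iO).
pose D := 1 + \sum_(k < n_nodes T) `|@node _ _ T k - @node _ _ T i|.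
have D1 : 1 <= D by rewrite lerDl sumr_ge0.
have D0 : 0 < D by apply: lt_le_trans D1.
(* The bound 1/2 ensures lam < 1, and r / D is the largest value that keeps lam * D below r; D is at
   least 1, so the division is safe. *)
pose r := s / 4; pose lam := Num.min (2^-1) (r / D).
have r0 : 0 < r by rewrite divr_gt0.
have lam0 : 0 < lam by rewrite lt_min invr_gt0 ltr0n divr_gt0.
apply: (@gradient_mass_sym_trunc i r lam) => //.
- by rewrite /lam gt_min invf_lt1 ?ltr1n ?ltr0n.
- by rewrite /r mulrC divfK// pnatr_eq0.
- by rewrite -/D -ler_pdivlMr// /lam ge_min lexx orbT.
Qed.

End symmetry.

(** * Spring constants as contractions of the elasticity tensor with gradient masses *)

Section spring_constants.
Context {R : realType} {d : nat} (Omega : set 'rV[R]_d) (T : mesh R d).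
Hypothesis hOmega : bounded_lipschitz_domain Omega.
Hypothesis hT : triangulation T Omega.
Variable phi : 'I_(n_nodes T) -> 'rV[R]_d -> R.
Hypothesis hphi : nodal_basis Omega phi.
Variable C : tensor4 R d.
Hypothesis hCmajor : major_symmetric C.
Hypothesis hCminor : minor_symmetric C.
Local Notation mu := (@lebesgue_rV R d).
Local Notation e p := (unit_rV R p).
Implicit Types (i j : 'I_(n_nodes T)) (k l p q r s : 'I_d) (x : 'rV[R]_d).

Let open_Omega : open Omega.
Proof. by case: hOmega. Qed.

Let bounded_Omega : bounded_set Omega.
Proof. by case: hOmega. Qed.

Let measurable_Omega : measurable Omega.
Proof. exact: open_measurable_rV. Qed.

(** [xget] picks an arbitrary representative, and uniqueness identifies it with [g] almost
    everywhere. The L^2 clause supplies the measurability that the exchange of almost everywhere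
    equal integrands requires. *)
Lemma weak_partial_ae (v g : 'rV[R]_d -> R) p : is_weak_partial Omega p v g ->
  measurable_fun Omega (weak_partial Omega p v) /\
  {ae mu, forall x, Omega x -> weak_partial Omega p v x = g x}.
Proof.
move=> vg; have vw : is_weak_partial Omega p v (weak_partial Omega p v).
  by apply: xgetPex; exists g.
split; last exact: weak_partial_unique vw vg.
by apply/measurable_restrictT => //; exact: L2_measurable vw.1.
Qed.

Lemma is_weak_partial0 p : is_weak_partial Omega p (cst 0) (cst 0).
Proof.
split.
  rewrite /L2 (_ : _ \_ _ = cst 0); last by apply/funext => x; rewrite patchE if_same.
  by apply: bmfun_L2; apply: (@bmfun_intro _ _ _ 0 0) => // x; rewrite normr0.
move=> psi _; under eq_Rintegral do rewrite mul0r.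
under [in RHS]eq_Rintegral do rewrite mul0r.
by rewrite Rintegral_cst// mul0r oppr0.
Qed.

Lemma is_weak_partial_displacement j l p q :
  is_weak_partial Omega q (fun y => (phi j y *: e l) ord0 p)
    (fun x => (p == l)%:R * @pw_partial _ _ T j q x).
Proof.
have [->|pl] := eqVneq p l.
  have -> : (fun y => (phi j y *: e l) ord0 l) = phi j.
    by apply/funext => y; rewrite !mxE !eqxx mulr1.
  have -> : (fun x => true%:R * @pw_partial _ _ T j q x) = @pw_partial _ _ T j q.
    by apply/funext => x; rewrite mul1r.
  exact: is_weak_partial_nodal.
have -> : (fun y => (phi j y *: e l) ord0 p) = cst 0.
  by apply/funext => y; rewrite !mxE (negbTE pl) andbF mulr0.
have -> : (fun x => false%:R * @pw_partial _ _ T j q x) = cst 0.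
  by apply/funext => x; rewrite mul0r.
exact: is_weak_partial0.
Qed.

Let strain_grad j l p q x : R := 2^-1 * ((p == l)%:R * @pw_partial _ _ T j q x +
  (q == l)%:R * @pw_partial _ _ T j p x).

Lemma strain_ae j l p q :
  measurable_fun Omega (strain Omega (fun y => phi j y *: e l) p q) /\
  {ae mu, forall x, Omega x ->
    strain Omega (fun y => phi j y *: e l) p q x = strain_grad j l p q x}.
Proof.
have [m1 e1] := weak_partial_ae (is_weak_partial_displacement j l p q).
have [m2 e2] := weak_partial_ae (is_weak_partial_displacement j l q p).
split.
  rewrite /strain; apply: (@measurable_funM _ _ _ _ (cst 2^-1)); first exact: measurable_cst.
  by apply: measurable_funD; [exact: m1|exact: m2].
apply: filterS2 e1 e2 => x E1 E2 Ox; rewrite /strain /strain_grad.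
by rewrite (E1 Ox) (E2 Ox).
Qed.

(** A displacement along [e l] has only its [l]-th component nonzero, and contraction with a
    symmetric matrix does not see the symmetrisation in the strain. It is applied twice: to [C] in
    its last two indices, then to the stress, symmetric by the minor symmetry in the first two. *)
Lemma sum_strain_grad (A : 'I_d -> 'I_d -> R) j l x : (forall r s, A r s = A s r) ->
  \sum_r \sum_s A r s * strain_grad j l r s x = \sum_s A l s * @pw_partial _ _ T j s x.
Proof.
move=> Asym.
pose S := \sum_r \sum_s A r s * ((r == l)%:R * @pw_partial _ _ T j s x).
have SE : S = \sum_s A l s * @pw_partial _ _ T j s x.
  rewrite /S (bigD1 l)//= [X in _ + X]big1 ?addr0.
    by apply: eq_bigr => s _; rewrite eqxx mul1r.
  by move=> r /negbTE rl; rewrite big1// => s _; rewrite rl mul0r mulr0.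
have SE' : \sum_r \sum_s A r s * ((s == l)%:R * @pw_partial _ _ T j r x) = S.
  rewrite exchange_big; apply: eq_bigr => r _; apply: eq_bigr => s _.
  by rewrite Asym.
have half (y : R) : y = 2^-1 * (y + y) by field.
rewrite -SE (half S) -{2}SE' -big_split mulr_sumr; apply: eq_bigr => r _.
rewrite -big_split mulr_sumr; apply: eq_bigr => s _ /=.
by rewrite mulrCA mulrDr.
Qed.

Let energy_grad i j k l x : R :=
  \sum_q \sum_s C k q l s * (@pw_partial _ _ T i q x * @pw_partial _ _ T j s x).

Lemma sum_energy_grad i j k l x :
  \sum_p \sum_q (\sum_r \sum_s C p q r s * strain_grad j l r s x) * strain_grad i k p q x =
  energy_grad i j k l x.
Proof.
rewrite (@sum_strain_grad (fun p q => \sum_r \sum_s C p q r s * strain_grad j l r s x)).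
  apply: eq_bigr => q _; rewrite sum_strain_grad; last by move=> r s; case: (hCminor k q r s).
  by rewrite mulr_suml; apply: eq_bigr => s _; rewrite -mulrA [_ * _ i q x]mulrC.
move=> p q; apply: eq_bigr => r _; apply: eq_bigr => s _.
by case: (hCminor p q r s) => ->.
Qed.

Lemma elastic_form_nodal i j k l :
  elastic_form C Omega (fun x => phi j x *: e l) (fun x => phi i x *: e k) =
  \sum_q \sum_s C k q l s * @gradient_mass _ _ T i j q s.
Proof.
pose c (a : 'I_(n_cells T)) := \sum_q \sum_s C k q l s * (cell_grad a i q * cell_grad a j s).
have -> : \sum_q \sum_s C k q l s * @gradient_mass _ _ T i j q s =
    \sum_a fine (mu (cell_interior a)) * c a.
  under [RHS]eq_bigr do rewrite mulr_sumr.
  rewrite [RHS]exchange_big; apply: eq_bigr => q _.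
  under [RHS]eq_bigr do rewrite mulr_sumr.
  rewrite [RHS]exchange_big; apply: eq_bigr => s _.
  by rewrite /gradient_mass mulr_sumr; apply: eq_bigr => a _; ring.
rewrite -Rintegral_sum_indic; last 2 first.
- by move=> a; exact: measurable_open_simplex.
- by move=> a; exact: (bounded_cell_interior hOmega hT).
(* Passing between [Omega] and the whole space uses that the open cells lie in [Omega]. *)
transitivity (\int[mu]_(x in Omega) (\sum_a c a * \1_(@cell_interior _ _ T a) x)); last first.
  rewrite Rintegral_mkcond; apply: eq_Rintegral => x _; rewrite patchE.
  case: ifPn => // /negP xO; rewrite big1// => a _; rewrite indicE memNset ?mulr0//.
  by move=> /(cell_interior_domain hOmega hT)/mem_set.
have mlhs : measurable_fun Omega (fun x =>
    \sum_p \sum_q stress C Omega (fun x => phi j x *: e l) p q x *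
      strain Omega (fun x => phi i x *: e k) p q x).
  apply: measurable_sum => p; apply: measurable_sum => q.
  apply: measurable_funM; last exact: (strain_ae i k p q).1.
  apply: measurable_sum => r; apply: measurable_sum => s.
  apply: (@measurable_funM _ _ _ _ (cst (C p q r s))); first exact: measurable_cst.
  exact: (strain_ae j l r s).1.
have mrhs : measurable_fun Omega (fun x => \sum_a c a * \1_(@cell_interior _ _ T a) x).
  apply: measurable_sum => a.
  apply: (@measurable_funM _ _ _ _ (cst (c a))); first exact: measurable_cst.
  by apply: measurable_indic; exact: measurable_open_simplex.
congr fine; apply: ae_eq_integral; [exact: measurable_Omega
  |by apply/measurable_EFinP; exact: mlhs|by apply/measurable_EFinP; exact: mrhs|].
have ae1 i' l' : {ae mu, forall x, forall pq : 'I_d * 'I_d, Omega x ->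
    strain Omega (fun y => phi i' y *: e l') pq.1 pq.2 x = strain_grad i' l' pq.1 pq.2 x}.
  by apply: filter_forall => -[p q]; have [] := strain_ae i' l' p q.
apply: filterS2 (filterI (ae1 i k) (ae1 j l)) (ae_cell_interior hT) => x [Hi Hj] Hx Ox.
have [a xa] := Hx (subset_closure Ox).
have Ei p q := Hi (p, q) Ox; have Ej r s := Hj (r, s) Ox.
congr EFin; transitivity (energy_grad i j k l x).
  rewrite -sum_energy_grad; apply: eq_bigr => p _; apply: eq_bigr => q _.
  rewrite -[strain_grad i k p q x]Ei; congr (_ * _).
  by apply: eq_bigr => r _; apply: eq_bigr => s _; rewrite -[strain_grad j l r s x]Ej.
have -> : \sum_(b < n_cells T) c b * \1_(cell_interior b) x = c a.
  rewrite (bigD1 a)//= indicE mem_set// mulr1 big1 ?addr0// => b ba.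
  rewrite indicE memNset ?mulr0// => xb.
  by move: ba; rewrite (cell_interior_disjoint hT xb (cell_interior_sub hT xa)) eqxx.

apply: eq_bigr => q _; apply: eq_bigr => s _.
by rewrite (pw_partialE hT i q xa) (pw_partialE hT j s xa).

Qed.

Lemma spring_constantE i j k l : spring_constant C Omega phi i j k l =
  - \sum_q \sum_s C k q l s * @gradient_mass _ _ T i j q s.
Proof. by rewrite mxE elastic_form_nodal. Qed.

(** The bilinear form is symmetric: the major symmetry exchanges the pairs (k, q) and (l, s), and
    [gradient_massC] exchanges the nodes accordingly. *)
Lemma spring_constant_transpose i j :
  spring_constant C Omega phi j i = (spring_constant C Omega phi i j)^T.
Proof.
apply/matrixP => k l; rewrite [RHS]mxE.
apply: (etrans (spring_constantE j i k l)); rewrite (spring_constantE i j l k).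
congr (- _); rewrite [LHS]exchange_big; apply: eq_bigr => s _; apply: eq_bigr => q _.
by rewrite (hCmajor k q l s) (gradient_massC j i).
Qed.

(** Writing B_ij(q, s) for the gradient mass, B_ij(q, s) = B_ij(s, q) because node [i] is interior,
    and B_ij(s, q) = B_ji(q, s) by commutativity of the product. *)
Lemma spring_constant_sym i j : Omega (@node _ _ T i) ->
  spring_constant C Omega phi i j = spring_constant C Omega phi j i.
Proof.
move=> iO; apply/matrixP => k l.
apply: (etrans (spring_constantE i j k l)); rewrite (spring_constantE j i k l).
congr (- _); apply: eq_bigr => q _; apply: eq_bigr => s _.
by rewrite (gradient_mass_sym hOmega hT hphi j q s iO) (gradient_massC i j).
Qed.

Lemma node_domain i : ~ boundary Omega (@node _ _ T i) -> Omega (@node _ _ T i).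
Proof.
move=> ni; apply: contrapT => nO; apply: ni; split; last by move=> /interior_subset.
have [_ _ /(_ i)[a ia] _ _] := hT.
exact: (cell_sub_closure hT (node_cell hT ia)).
Qed.

End spring_constants.

Theorem theorem4p3 (R : realType) (d : nat) (hd : d = 2%N \/ d = 3%N)
    (Omega : set 'rV[R]_d)
    (hOmega : bounded_lipschitz_domain Omega)
    (hGamma : polyhedral_boundary Omega)
    (T : mesh R d) (hT : triangulation T Omega)
    (phi : 'I_(n_nodes T) -> 'rV[R]_d -> R)
    (hphi : nodal_basis Omega phi)
    (C : tensor4 R d)
    (hCpos : positive_definite C)
    (hCmajor : major_symmetric C)
    (hCminor : minor_symmetric C)
    (i j : 'I_(n_nodes T))
    (hij : j \in neighbours C Omega phi i)
    (hGammaij : ~ ([set node i; node j] `<=` boundary Omega)) :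
  spring_constant C Omega phi i j = spring_constant C Omega phi j i /\
  spring_constant C Omega phi j i = (spring_constant C Omega phi i j)^T.
Proof.
split; last exact: (spring_constant_transpose hOmega hT hphi).
(* The equality is symmetric in the two nodes, so whichever of them is off the boundary can play the
   role of the interior node. *)
have [ni|ni] := pselect (boundary Omega (node i)); last first.
  by apply: (spring_constant_sym hOmega hT hphi) => //; exact: node_domain.
have nj : ~ boundary Omega (node j) by move=> nj; apply: hGammaij => x [->|->].
apply/esym/(spring_constant_sym hOmega hT hphi) => //; exact: node_domain.
Qed.
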